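(* Let $T$ be a complete continuous logic theory with monster model $\mathfrak{C}$. The following are equivalent: (1) $T$ is $n$-dependent; (2) every $G_{n+1,p}$-indiscernible sequence is $\mathcal{L}_{op}$-indiscernible; (3) every $G_{n+1}$-indiscernible sequence is order-indiscernible.
   Context: A formula $f(x,y_0,\dots,y_{n-1})$ has $IP_n$ if there are $r<s$ in $\mathbb{R}$ and $(a_{0,i},\dots,a_{n-1,i})_{i<\omega}$ such that for every finite $w\subseteq\omega^n$ there is $b_w$ with $f(b_w,a_{0,i_0},\dots,a_{n-1,i_{n-1}})\le r\iff(i_0,\dots,i_{n-1})\in w$ and $\ge s\iff(i_0,\dots,i_{n-1})\notin w$. $T$ is $n$-dependent if no formula has $IP_n$. Languages: $\mathcal{L}_{op}=\{<,P_0,\dots,P_n\}$, $\mathcal{L}_{og}=\{<,R\}$, $\mathcal{L}_{opg}=\{<,R,P_0,\dots,P_n\}$ with $R$ $(n+1)$-ary. $G_{n+1}$ is the Fraïssé limit of finite ordered $(n+1)$-uniform hypergraphs (linear order $<$, symmetric $R$ holding only on pairwise distinct tuples), in $\mathcal{L}_{og}$. $G_{n+1,p}$ is the Fraïssé limit of finite ordered $(n+1)$-partite $(n+1)$-uniform hypergraphs (universe $P_0\sqcup\dots\sqcup P_n$, linear order with $P_0<\dots<P_n$, symmetric $R$ with $R(a_0,\dots,a_n)$ implying each $P_i$ meets $\{a_0,\dots,a_n\}$ in exactly one point), in $\mathcal{L}_{opg}$. For a structure $\mathcal{I}$ and a sublanguage $\mathcal{L}_0$ of its language, a sequence $(a_i)_{i\in\mathcal{I}}$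 in $\mathfrak{C}$ is $\mathcal{L}_0$-indiscernible if for all finite tuples $\bar i,\bar j$ from $\mathcal{I}$ with the same quantifier-free $\mathcal{L}_0$-type, $\mathrm{tp}(a_{\bar i})=\mathrm{tp}(a_{\bar j})$. $G_{n+1,p}$-indiscernible means $\mathcal{L}_{opg}$-indiscernible for sequences indexed by $G_{n+1,p}$; $G_{n+1}$-indiscernible means $\mathcal{L}_{og}$-indiscernible for sequences indexed by $G_{n+1}$; order-indiscernible means $\{<\}$-indiscernible. *)

(* Defs.v *)
From HB Require Import structures.
From mathcomp Require Import all_boot all_order all_algebra fingroup perm.
From mathcomp Require Import boolp classical_sets reals.
From mathcomp Require Import Rstruct.
Notation R := Rdefinitions.R.

Set Implicit Arguments.
Unset Strict Implicit.
Unset Printing Implicit Defensive.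

Import Order.TTheory GRing.Theory Num.Theory.
Local Open Scope ring_scope.

Record cstruct := CStruct {
  carrier :> Type;
  psym : Type;
  par : psym -> nat;
  pint : forall p : psym, ('I_(par p) -> carrier) -> R;
  fsym : Type;
  far : fsym -> nat;
  fint : forall f : fsym, ('I_(far f) -> carrier) -> carrier;
  dist : carrier -> carrier -> R }.
Arguments pint {c} p _.
Arguments fint {c} f _.

Definition is_cstruct (M : cstruct) : Prop :=
  inhabited M /\
  (forall x y : M, 0 <= dist x y <= 1) /\
  (forall x y : M, dist x y = 0 <-> x = y) /\
  (forall x y : M, dist x y = dist y x) /\
  (forall x y z : M, dist x z <= dist x y + dist y z) /\
  (forall u : nat -> M,
      (forall e : R, 0 < e -> exists N : nat, forall p q : nat, (N <= p)%N -> (N <= q)%N ->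
          dist (u p) (u q) < e) ->
      exists x : M, forall e : R, 0 < e -> exists N : nat, forall p : nat, (N <= p)%N ->
          dist (u p) x < e) /\
  (forall (p : psym M) t, 0 <= pint p t <= 1) /\
  (forall (p : psym M) (e : R), 0 < e -> exists d : R, 0 < d /\
      forall t t' : 'I_(par p) -> M, (forall i, dist (t i) (t' i) < d) ->
        `|pint p t - pint p t'| < e) /\
  (forall (f : fsym M) (e : R), 0 < e -> exists d : R, 0 < d /\
      forall t t' : 'I_(far f) -> M, (forall i, dist (t i) (t' i) < d) ->
        dist (fint f t) (fint f t') < e).

(* Terms, as their interpretations (functions of an assignment of the
   variables in the finite type V). *)
Inductive isTerm (M : cstruct) (V : finType) : ((V -> M) -> M) -> Prop :=
| tVar (v : V) : isTerm (fun e => e v)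
| tFun (f : fsym M) (ts : 'I_(far f) -> (V -> M) -> M) :
    (forall i, isTerm (ts i)) -> isTerm (fun e => fint f (fun i => ts i e)).

Definition in_cube (m : nat) (x : 'I_m -> R) := forall i, 0 <= x i <= 1.

Definition connective (m : nat) (u : ('I_m -> R) -> R) : Prop :=
  (forall x, in_cube x -> 0 <= u x <= 1) /\
  (forall x, in_cube x -> forall eps : R, 0 < eps -> exists del : R, 0 < del /\
     forall y, in_cube y -> (forall i, `|x i - y i| < del) -> `|u x - u y| < eps).

Definition ext (M : Type) (V : Type) (e : V -> M) (a : M) : option V -> M :=
  fun o => match o with Some v => e v | None => a end.

(* Formulas (without parameters), as their interpretations in M:
   atomic formulas P(t..), d(t1,t2); continuous connectives; sup / inf. *)
Inductive isFormula (M : cstruct) : forall V : finType, ((V -> M) -> R) -> Prop :=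
| fPred (V : finType) (p : psym M) (ts : 'I_(par p) -> (V -> M) -> M) :
    (forall i, isTerm (ts i)) -> isFormula (fun e => pint p (fun i => ts i e))
| fDist (V : finType) (t1 t2 : (V -> M) -> M) :
    isTerm t1 -> isTerm t2 -> isFormula (fun e => dist (t1 e) (t2 e))
| fConn (V : finType) (m : nat) (u : ('I_m -> R) -> R) (phis : 'I_m -> (V -> M) -> R) :
    connective u -> (forall i, isFormula (phis i)) ->
    isFormula (fun e => u (fun i => phis i e))
| fSup (V : finType) (phi : (option V -> M) -> R) :
    isFormula phi -> isFormula (fun e : V -> M => sup (range (fun a => phi (ext e a))))
| fInf (V : finType) (phi : (option V -> M) -> R) :
    isFormula phi -> isFormula (fun e : V -> M => inf (range (fun a => phi (ext e a)))).

Definition same_type (M : cstruct) (J : Type) (X Y : J -> M) : Prop :=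
  forall (V : finType) (g : V -> J) (phi : (V -> M) -> R),
    isFormula phi -> phi (fun v => X (g v)) = phi (fun v => Y (g v)).

(* Monster model: kappa-saturated and strongly kappa-homogeneous, with   *)
(* "small" meaning of cardinality <= 2^aleph0 + |L|.                     *)

Definition small (M : cstruct) (K : Type) : Prop :=
  exists f : K -> (R * option (psym M + fsym M))%type, injective f.

Record condition (M : cstruct) := Cond {
  cV : finType;
  cphi : (option cV -> M) -> R;
  cpar : cV -> M }.
Arguments cV {M} c.
Arguments cphi {M} c _.
Arguments cpar {M} c _.

Definition cond_sat (M : cstruct) (c : condition M) (x : M) : Prop :=
  cphi c (ext (cpar c) x) = 0.

Definition saturated (M : cstruct) : Prop :=
  forall (A : M -> Prop), small M {x : M | A x} ->
  forall (J : Type) (Sigma : J -> condition M),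
    (forall j, isFormula (cphi (Sigma j)) /\ forall v, A (cpar (Sigma j) v)) ->
    (forall (m : nat) (g : 'I_m -> J), exists x : M, forall i, cond_sat (Sigma (g i)) x) ->
    exists x : M, forall j, cond_sat (Sigma j) x.

Definition automorphism (M : cstruct) (s : M -> M) : Prop :=
  bijective s /\
  (forall (p : psym M) t, pint p (fun i => s (t i)) = pint p t) /\
  (forall (f : fsym M) t, fint f (fun i => s (t i)) = s (fint f t)) /\
  (forall x y, dist (s x) (s y) = dist x y).

Definition strongly_homogeneous (M : cstruct) : Prop :=
  forall (K : Type), small M K -> forall X Y : K -> M, same_type X Y ->
    exists s, automorphism s /\ forall k, s (X k) = Y k.

Definition monster (M : cstruct) : Prop :=
  is_cstruct M /\ saturated M /\ strongly_homogeneous M.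

(* A formula f(x, y_0, ..., y_{n-1}) has variables V, and [part v] says
   whether v belongs to x (None) or to y_j (Some j). *)
Definition ip_assign (M : Type) (n : nat) (V : Type) (part : V -> option 'I_n)
  (b : V -> M) (a : 'I_n -> nat -> V -> M) (iota : {ffun 'I_n -> nat}) : V -> M :=
  fun v => match part v with None => b v | Some j => a j (iota j) v end.

Definition has_IP (M : cstruct) (n : nat) (V : finType) (part : V -> option 'I_n)
  (f : (V -> M) -> R) : Prop :=
  exists r s : R, r < s /\
  exists a : 'I_n -> nat -> V -> M,
  forall w : seq {ffun 'I_n -> nat}, exists b : V -> M,
  forall iota : {ffun 'I_n -> nat},
    (f (ip_assign part b a iota) <= r <-> iota \in w) /\
    (f (ip_assign part b a iota) >= s <-> iota \notin w).

Definition n_dependent (M : cstruct) (n : nat) : Prop :=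
  ~ exists (V : finType) (part : V -> option 'I_n) (f : (V -> M) -> R),
      isFormula f /\ has_IP part f.

Record opg_on (n : nat) (I : Type) := OPG {
  olt : I -> I -> Prop;
  oR : ('I_n.+1 -> I) -> Prop;
  oP : 'I_n.+1 -> I -> Prop }.

Record og_on (n : nat) (I : Type) := OG {
  glt : I -> I -> Prop;
  gR : ('I_n.+1 -> I) -> Prop }.

Definition strict_linear (I : Type) (lt : I -> I -> Prop) : Prop :=
  (forall x, ~ lt x x) /\ (forall x y z, lt x y -> lt y z -> lt x z) /\
  (forall x y, x <> y -> lt x y \/ lt y x).

Definition symmetric_rel (n : nat) (I : Type) (Rel : ('I_n.+1 -> I) -> Prop) : Prop :=
  forall (a : 'I_n.+1 -> I) (s : {perm 'I_n.+1}), Rel a -> Rel (fun k => a (s k)).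

Definition is_ohg (n : nat) (I : Type) (G : og_on n I) : Prop :=
  strict_linear (glt G) /\ symmetric_rel (gR G) /\
  (forall a, gR G a -> injective a).

Definition is_ophg (n : nat) (I : Type) (G : opg_on n I) : Prop :=
  strict_linear (olt G) /\
  (forall x, exists! i, oP G i x) /\
  (forall (i j : 'I_n.+1) x y, (i < j)%N -> oP G i x -> oP G j y -> olt G x y) /\
  symmetric_rel (oR G) /\
  (forall a, oR G a -> forall i : 'I_n.+1,
     exists x, oP G i x /\ (exists k, a k = x) /\ (forall k, oP G i (a k) -> a k = x)).

Definition og_embedding (n : nat) (I J : Type) (F : og_on n I) (G : og_on n J)
  (f : I -> J) : Prop :=
  injective f /\ (forall x y, glt F x y <-> glt G (f x) (f y)) /\
  (forall a, gR F a <-> gR G (fun k => f (a k))).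

Definition opg_embedding (n : nat) (I J : Type) (F : opg_on n I) (G : opg_on n J)
  (f : I -> J) : Prop :=
  injective f /\ (forall x y, olt F x y <-> olt G (f x) (f y)) /\
  (forall a, oR F a <-> oR G (fun k => f (a k))) /\
  (forall i x, oP F i x <-> oP G i (f x)).

(* equality of quantifier-free types of finite tuples, in the various
   sublanguages (equality is always part of the qf type) *)
Definition qf_eq_lt (I : Type) (lt : I -> I -> Prop) (m : nat) (u v : 'I_m -> I) :=
  (forall i j, u i = u j <-> v i = v j) /\ (forall i j, lt (u i) (u j) <-> lt (v i) (v j)).

Definition qf_R (n : nat) (I : Type) (Rel : ('I_n.+1 -> I) -> Prop) (m : nat) (u v : 'I_m -> I) :=
  forall s : 'I_n.+1 -> 'I_m, Rel (fun k => u (s k)) <-> Rel (fun k => v (s k)).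

Definition qf_P (n : nat) (I : Type) (P : 'I_n.+1 -> I -> Prop) (m : nat) (u v : 'I_m -> I) :=
  forall (k : 'I_n.+1) (i : 'I_m), P k (u i) <-> P k (v i).

Definition countable_type (I : Type) : Prop := exists f : I -> nat, injective f.

Definition is_G (n : nat) (I : Type) (G : og_on n I) : Prop :=
  is_ohg G /\ countable_type I /\
  (forall (m : nat) (F : og_on n 'I_m), is_ohg F -> exists f, og_embedding F G f) /\
  (forall (m : nat) (u v : 'I_m -> I), injective u -> injective v ->
     (forall i j, glt G (u i) (u j) <-> glt G (v i) (v j)) -> qf_R (gR G) u v ->
     exists s : I -> I, bijective s /\ og_embedding G G s /\ forall i, s (u i) = v i).

Definition is_Gp (n : nat) (I : Type) (G : opg_on n I) : Prop :=
  is_ophg G /\ countable_type I /\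
  (forall (m : nat) (F : opg_on n 'I_m), is_ophg F -> exists f, opg_embedding F G f) /\
  (forall (m : nat) (u v : 'I_m -> I), injective u -> injective v ->
     (forall i j, olt G (u i) (u j) <-> olt G (v i) (v j)) -> qf_R (oR G) u v ->
     qf_P (oP G) u v ->
     exists s : I -> I, bijective s /\ opg_embedding G G s /\ forall i, s (u i) = v i).

Definition seq_tuple (M : Type) (I K : Type) (a : I -> K -> M) (m : nat) (u : 'I_m -> I)
  : ('I_m * K)%type -> M := fun p => a (u p.1) p.2.

Definition opg_indiscernible (M : cstruct) (n : nat) (I K : Type) (G : opg_on n I)
  (a : I -> K -> M) : Prop :=
  forall (m : nat) (u v : 'I_m -> I),
    qf_eq_lt (olt G) u v -> qf_R (oR G) u v -> qf_P (oP G) u v ->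
    same_type (seq_tuple a u) (seq_tuple a v).

Definition op_indiscernible (M : cstruct) (n : nat) (I K : Type) (G : opg_on n I)
  (a : I -> K -> M) : Prop :=
  forall (m : nat) (u v : 'I_m -> I),
    qf_eq_lt (olt G) u v -> qf_P (oP G) u v ->
    same_type (seq_tuple a u) (seq_tuple a v).

Definition og_indiscernible (M : cstruct) (n : nat) (I K : Type) (G : og_on n I)
  (a : I -> K -> M) : Prop :=
  forall (m : nat) (u v : 'I_m -> I),
    qf_eq_lt (glt G) u v -> qf_R (gR G) u v ->
    same_type (seq_tuple a u) (seq_tuple a v).

Definition order_indiscernible (M : cstruct) (I K : Type) (lt : I -> I -> Prop)
  (a : I -> K -> M) : Prop :=
  forall (m : nat) (u v : 'I_m -> I),
    qf_eq_lt lt u v -> same_type (seq_tuple a u) (seq_tuple a v).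

(* Main.v *)
Require Import Defs.
From HB Require Import structures.
From mathcomp Require Import all_boot all_order all_algebra fingroup perm.
From mathcomp Require Import boolp classical_sets reals.
From mathcomp Require Import Rstruct.
From mathcomp Require Import filter ring lra fintype finset.

(* If a sequence indexed by one of the two generic structures is indiscernible
   for its full language but not for its order (and parts), then changing one
   edge e of a finite configuration changes the value of some formula. Blowing up
   the points of e to copies related by an arbitrary (n+1)-partite hypergraph,
   and embedding the result in the generic structure, shows that this formula,
   with the other points absorbed in x, has IP_n.

   Conversely, IP_n provides for every N tuples A_x, x in {0,1}^N, such that f
   detects whether the n+1 words x_0, ..., x_n have a common coordinate 1. Every
   finite ordered hypergraph B embeds in this hypergraph of words, by sending b to
   the word (b in S)_S where S runs, in colexicographic order, over the edges of B
   and its subsets of size at most n. For A inside B, the order of first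
   appearance of the traces of the S's on A depends only on the isomorphism type
   of A, so that the dual Ramsey theorem (proved from the Hales-Jewett theorem)
   makes finitely many formulas approximately constant on each isomorphism type of
   tuples. An ultrafilter limit, realized one variable at a time by saturation,
   is an indiscernible sequence indexed by any countable ordered hypergraph, in
   which f still detects the edges. *)

(** The obstacle is to make formulas constant on isomorphism types without losing the edges that f
    detects. Coding vertices by words overcomes it: a substitution of parameter words acts on the
    coordinates of all vertices at once, and since every parameter occurs it preserves having a
    common coordinate 1. The sets of size at most n make the family of S's closed under traces: the
    trace of S on A is first met at the intersection of S and A, which the colexicographic order
    never places after S. The variables of f play different roles whereas edges are symmetric. Each
    A_x therefore gives values to all variables of f, and an instance of f takes one part from each
    of n+1 words. The indiscernible sequence is built over an arbitrary ordered hypergraph, without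
    parts. The partite generic structure is in particular such a hypergraph, so one construction
    refutes both (2) and (3), by an edge and a non-edge with the same order and parts. The generic
    structures have to be constructed for this, since (2) and (3) would be vacuous without them. *)

Set Implicit Arguments.
Unset Strict Implicit.
Unset Printing Implicit Defensive.

(** * Parameter words and the dual Ramsey theorem *)

(* Parameter words: the letters below [c] are constants, and the parameters
   [c], ..., [d.-1] all occur, their first occurrences being in this order. *)
Fixpoint rgw (c d : nat) (w : seq nat) : bool :=
  if w is x :: w' then
    if x < c then rgw c d w' else (x == c) && rgw c.+1 d w'
  else c == d.

(* Substitutes the letters of [v] for the parameters [k], [k.+1], ... of [w]. *)
Definition wsub (k : nat) (v w : seq nat) : seq nat :=
  [seq nth 0 (iota 0 k ++ v) x | x <- w].

Lemma rgw_le c d w : rgw c d w -> c <= d.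
Proof.
elim: w c => [|x w IH] c /=; first by move/eqP->.
by case: ltnP => _; [exact: IH | case/andP=> _ /IH /ltnW].
Qed.

Lemma rgw_lt c d w : rgw c d w -> all (fun x => x < d) w.
Proof.
elim: w c => [|x w IH] c //=.
case: ltnP => [xc h|_ /andP[/eqP-> h]]; rewrite (IH _ h) andbT.
  exact: leq_trans xc (rgw_le h).
exact: rgw_le h.
Qed.

Lemma rgw_const c w : all (fun x => x < c) w -> rgw c c w.
Proof. by elim: w => [|x w IH] //= /andP[-> /IH]. Qed.

Lemma rgw_cat c d e x y : rgw c d x -> rgw d e y -> rgw c e (x ++ y).
Proof.
elim: x c => [|a x IH] c /=; first by move/eqP->.
by case: ltnP => _; [exact: IH | case/andP=> -> /IH h /h].
Qed.

(** The letters of [x] are below [e], so the cut is at the first occurrence of the parameter [e]. *)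
Lemma rgw_split c d e w : rgw c d w -> c <= e -> e < d ->
  exists x y, [/\ w = x ++ e :: y, rgw c e x & rgw e.+1 d y].
Proof.
elim: w c => [|a w IH] c /=; first by move/eqP-> => h1 h2; have := leq_ltn_trans h1 h2; rewrite ltnn.
case: ltnP => [ac h ce ed|_ /andP[/eqP-> h]].
  have [x [y [-> h1 h2]]] := IH _ h ce ed.
  by exists (a :: x), y; rewrite /= ac.
rewrite leq_eqVlt => /orP[/eqP<- _|ce ed].
  by exists [::], w; rewrite /= eqxx.
have [x [y [-> h1 h2]]] := IH _ h ce ed.
by exists (c :: x), y; rewrite /= ltnn eqxx.
Qed.

Lemma rgw_mem c d e w : rgw c d w -> c <= e -> e < d -> e \in w.
Proof.
move=> h h1 h2; have [x [y [-> _ _]]] := rgw_split h h1 h2.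
by rewrite mem_cat in_cons eqxx orbT.
Qed.

Lemma rgw_iota c m : rgw c (c + m) (iota c m).
Proof.
elim: m c => [|m IH] c /=; first by rewrite addn0.
by rewrite ltnn eqxx /= addnS -addSn.
Qed.

Lemma rgw_index c d w : c <= d -> all (fun x => x < d) w ->
  (forall j, c <= j < d -> j \in w) ->
  (forall j j', c <= j < j' -> j' < d -> index j w < index j' w) -> rgw c d w.
Proof.
elim: w c => [|x w IH] c /=.
  move=> cd _ h _; rewrite eqn_leq cd leqNgt; apply/negP => lt.
  by have := h c; rewrite leqnn lt in_nil => /(_ isT).
move=> cd /andP[xd al] mem idx; case: ltnP => [xc|cx].
  apply: IH => // [j /andP[cj jd]|j j' /andP[cj jj'] jd].
    have := mem j; rewrite cj jd in_cons => /(_ isT) /orP[/eqP E|//].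
    by move: xc; rewrite -E ltnNge cj.
  have := idx j j'; rewrite cj jj' jd !ifN ?ltnS; first by move=> /(_ isT isT).
    by rewrite neq_ltn (leq_trans xc (ltnW (leq_ltn_trans cj jj'))).
  by rewrite neq_ltn (leq_trans xc cj).
have E : x = c.
  apply/eqP; rewrite eqn_leq cx andbT leqNgt; apply/negP => lt.
  have := idx c x; rewrite leqnn lt xd => /(_ isT isT) /=.
  by rewrite eqxx; case: ifP.
subst x; rewrite eqxx /=; apply: IH => // [j /andP[cj jd]|j j' /andP[cj jj'] jd].
  have := mem j; rewrite (ltnW cj) jd in_cons => /(_ isT) /orP[/eqP E|//].
  by move: cj; rewrite E ltnn.
have := idx j j'; rewrite (ltnW cj) jj' jd !ifN ?ltnS; first by move=> /(_ isT isT).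
  by rewrite neq_ltn (ltn_trans cj jj').
by rewrite neq_ltn cj.
Qed.

Lemma size_wsub k v w : size (wsub k v w) = size w.
Proof. exact: size_map. Qed.

Lemma wsub_cat k v x y : wsub k v (x ++ y) = wsub k v x ++ wsub k v y.
Proof. exact: map_cat. Qed.

Lemma wsub_nth_lo k v x : x < k -> nth 0 (iota 0 k ++ v) x = x.
Proof. by move=> h; rewrite nth_cat size_iota h nth_iota. Qed.

Lemma wsub_nth_hi k v x : nth 0 (iota 0 k ++ v) (k + x) = nth 0 v x.
Proof. by rewrite nth_cat size_iota ltnNge leq_addr addKn. Qed.

Lemma rgw_wsub k c d n v w : rgw k (k + n) w -> size v = n -> k <= c ->
  rgw c d v -> rgw c d (wsub k v w).
Proof.
move=> hw sv kc hv.
(* Here [i] parameters of [w] have been read, and [e] bounds the letters available so far. A letter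
   of [v] can occur for the first time only where a parameter of [w] does. *)
suff H i e : i <= n -> k <= e -> all (fun x => x < e) (take i v) -> rgw e d (drop i v) ->
    rgw (k + i) (k + n) w -> rgw e d (wsub k v w).
  by apply: (H 0); rewrite ?take0 ?drop0 ?addn0.
move=> {hw hv kc}; elim: w i e => [|x w IH] i e ile ke al hd /=.
  by rewrite eqn_add2l => /eqP E; move: hd; rewrite E -sv drop_size.
case: ltnP => [xki|_ /andP[/eqP-> hw]].
  suff -> : nth 0 (iota 0 k ++ v) x < e by move=> hw; exact: (IH i).
  case: (ltnP x k) => [xk|kx]; first by rewrite wsub_nth_lo // (leq_trans xk ke).
  rewrite -(subnKC kx) wsub_nth_hi; rewrite -(subnKC kx) ltn_add2l in xki.
  move/allP: al; apply; rewrite -(nth_take _ xki); apply: mem_nth.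
  by rewrite size_take_min sv (minn_idPl ile).
rewrite wsub_nth_hi.
have lin : i < n.
  by have := rgw_le hw; rewrite ltn_add2l.
rewrite (drop_nth 0) ?sv // in hd; move: hd => /=.
have tk : take i.+1 v = rcons (take i v) (nth 0 v i) by rewrite (take_nth 0) ?sv.
case: ltnP => [lt hd|_ /andP[/eqP E hd]].
  apply: (IH i.+1) => //; last by rewrite addnS.
  by rewrite tk all_rcons lt.
rewrite E eqxx /=; apply: (IH i.+1) => //; last by rewrite addnS.
- exact: leqW.
rewrite tk all_rcons E leqnn /=; apply: sub_all al => y h; exact: leqW.
Qed.

Lemma wsub_assoc k u v w : all (fun x => x < k + size v) w ->
  wsub k u (wsub k v w) = wsub k (wsub k u v) w.
Proof.
move=> al; rewrite /wsub -map_comp; apply/eq_in_map => x xw /=.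
have := allP al _ xw => /= lt; case: (ltnP x k) => [xk|kx]; first by rewrite !wsub_nth_lo.
rewrite -(subnKC kx) !wsub_nth_hi (nth_map 0) //.
by rewrite -(ltn_add2l k) subnKC.
Qed.

(** Moving the parameters of [w] up turns the letters from [k] to [k'.-1] into constants, without
    changing the words obtained by substitution. *)
Lemma wsub_shift k k' m v w : all (fun x => x < k + m) w -> k <= k' ->
  wsub k' v (wsub k (iota k' m) w) = wsub k v w.
Proof.
move=> al kk; rewrite /wsub -map_comp; apply/eq_in_map => x xw /=.
have := allP al _ xw => /= lt; case: (ltnP x k) => [xk|kx].
  by rewrite !wsub_nth_lo // (leq_trans xk).
by rewrite -(subnKC kx) !wsub_nth_hi nth_iota ?wsub_nth_hi // -(ltn_add2l k) subnKC.
Qed.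

Lemma wsub_all_lt k d u w : k <= d -> all (fun x => x < d) u ->
  all (fun x => x < k + size u) w -> all (fun x => x < d) (wsub k u w).
Proof.
move=> kd /allP al /allP aw; apply/allP => _ /mapP[x xw ->].
have := aw _ xw => /= lt; case: (ltnP x k) => [xk|kx]; first by rewrite wsub_nth_lo // (leq_trans xk).
by rewrite -(subnKC kx) wsub_nth_hi; apply/al/mem_nth; rewrite -(ltn_add2l k) subnKC.
Qed.

Lemma wsub_flip k (v w : seq nat) : all (fun x => x < k.+1 + size v) w ->
  map (minn k) (wsub k.+1 v w) = wsub k.+1 (map (minn k) v) w.
Proof.
move=> al; rewrite /wsub -map_comp; apply/eq_in_map => x xw /=.
have := allP al _ xw => /= lt; case: (ltnP x k.+1) => [xk|kx].
  by rewrite !(wsub_nth_lo _ xk); apply/minn_idPr.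
rewrite -(subnKC kx) !(wsub_nth_hi k.+1) (nth_map 0) //.
by rewrite -(ltn_add2l k.+1) subnKC.
Qed.

Lemma wsub_prefix k (u v w : seq nat) : all (fun x => x < k + size u) w ->
  wsub k (u ++ v) w = wsub k u w.
Proof.
move=> /allP al; apply/eq_in_map => x /al lt; rewrite catA nth_cat.
by rewrite size_cat size_iota lt.
Qed.

Lemma wsub_nseq k v i x : wsub k v (nseq i x) = nseq i (nth 0 (iota 0 k ++ v) x).
Proof. exact: map_nseq. Qed.

Lemma wsub_iota (k : nat) (a b : seq nat) : wsub k (a ++ b) (iota k (size a)) = a.
Proof.
apply: (@eq_from_nth _ 0); rewrite size_wsub size_iota // => i lt.
by rewrite (nth_map 0) ?size_iota // nth_iota // wsub_nth_hi nth_cat lt.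
Qed.

(* The step of Shelah's proof of the Hales-Jewett theorem: on a suitable
   subspace the colour ignores the difference between the two largest letters,
   which reduces the size of the alphabet by one. *)
Lemma shelah_insensitive k n : forall C : finType, exists N, forall chi : seq nat -> C,
  exists w, [/\ size w = N, rgw k.+2 (k.+2 + n) w &
    forall v, size v = n -> all (fun x => x < k.+2) v ->
      chi (wsub k.+2 v w) = chi (wsub k.+2 (map (minn k) v) w)].
Proof.
elim: n => [|n IH] C.
  by exists 0 => chi; exists [::]; rewrite /= addn0 eqxx; split=> // -[].
have [N1 H1] := IH {ffun 'I_k.+2 -> C}.
pose T : finType := {ffun N1.-tuple 'I_k.+2 -> C}.
(* The [L.+1] words [y i] outnumber the colourings of the prefixes, so two of them induce the same
   colouring. *)
pose L := #|T|; exists (N1 + L) => chi.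
pose y i := nseq i k ++ nseq (L - i) k.+1.
pose F (i : 'I_L.+1) : T := [ffun s : N1.-tuple 'I_k.+2 => chi (map val s ++ y i)].
have [i [j [ij Fij]]] : exists i j : 'I_L.+1, i < j /\ F i = F j.
  apply: contrapT => no.
  have inj : injective F.
    move=> i j E; case: (ltngtP i j) => [lt|lt|/val_inj//]; case: no.
      by exists i, j.
    by exists j, i.
  by have := leq_card F inj; rewrite card_ord ltnn.
(* The block between [i] and [j] becomes the new parameter: filled with [k] it gives [y j], filled
   with [k.+1] it gives [y i]. *)
pose z l := nseq i k ++ nseq (j - i) l ++ nseq (L - j) k.+1.
have jL : j <= L by rewrite -ltnS.
have zk : z k = y j by rewrite /z catA -nseqD subnKC // ltnW.
have zk1 : z k.+1 = y i.
  by rewrite /z /y -nseqD addnC addnBA ?(ltnW ij) // subnK.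
have zz s : size s = N1 -> all (fun x => x < k.+2) s -> chi (s ++ z k.+1) = chi (s ++ z k).
  move=> ss al.
  have st : size (map (fun x => inord x : 'I_k.+2) s) == N1 by rewrite size_map ss.
  have E : map val (Tuple st) = s.
    rewrite -map_comp -[RHS]map_id; apply/eq_in_map => x /(allP al) /= h; by rewrite inordK.
  have := congr1 (fun f : T => f (Tuple st)) Fij.
  by rewrite !ffunE E zk zk1.
(* A prefix is coloured by the function of the last letter it induces, so that one application of
   the induction hypothesis serves for all last letters. *)
have [w [sw rw Hw]] := H1 (fun s => [ffun l : 'I_k.+2 => chi (s ++ z l)]).
exists (w ++ z (k.+2 + n)); split.
- rewrite size_cat sw !size_cat !size_nseq; congr (_ + _).
  by rewrite addnA subnKC ?(ltnW ij) // subnKC.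
- apply: rgw_cat rw _.
  apply: (@rgw_cat _ (k.+2 + n)).
    by apply: rgw_const; rewrite all_nseq ltn_addr ?orbT.
  apply: (@rgw_cat _ (k.+2 + n.+1)).
    rewrite -(subnSK ij) /= ltnn eqxx /= addnS; apply: rgw_const.
    by rewrite all_nseq ltnS leqnn orbT.
  by apply: rgw_const; rewrite all_nseq ltn_addr ?orbT.
case/lastP=> // v l; rewrite size_rcons => -[sv]; rewrite all_rcons => /andP[ll al].
have E u m : size u = n -> wsub k.+2 (rcons u m) (w ++ z (k.+2 + n)) = wsub k.+2 u w ++ z m.
  move=> su; rewrite wsub_cat -cats1 wsub_prefix; last by rewrite su; exact: rgw_lt rw.
  congr (_ ++ _); rewrite !wsub_cat !wsub_nseq wsub_nth_hi !wsub_nth_lo //.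
  by rewrite nth_cat su ltnn subnn.
rewrite map_rcons !E ?size_map //.
have := Hw _ sv al => /(congr1 (fun f : {ffun _} => f (Ordinal ll))).
rewrite !ffunE /= => ->.
move: ll; rewrite ltnS leq_eqVlt => /orP[/eqP->|lk]; last by rewrite (minn_idPr _).
rewrite (minn_idPl _) //; apply: zz; first by rewrite size_wsub.
apply: wsub_all_lt => //.
  by apply/allP => _ /mapP[x _ ->]; rewrite gtn_min leqnSn.
by rewrite size_map sv; exact: rgw_lt rw.
Qed.

(** Induction on the alphabet, trivial for at most one letter. On a subspace where [k] and [k.+1]
    are interchangeable, words may be folded by [minn k], and the theorem for one letter less
    applies to the folded words. *)
Theorem hales_jewett k : forall m (C : finType), exists N, forall chi : seq nat -> C,
  exists w, [/\ size w = N, rgw k (k + m) w &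
    forall v v', size v = m -> size v' = m ->
      all (fun x => x < k) v -> all (fun x => x < k) v' -> chi (wsub k v w) = chi (wsub k v' w)].
Proof.
have triv m (C : finType) l : (forall v v', size v = m -> size v' = m ->
      all (fun x => x < l) v -> all (fun x => x < l) v' -> v = v') ->
  exists N, forall chi : seq nat -> C,
  exists w, [/\ size w = N, rgw l (l + m) w &
    forall v v', size v = m -> size v' = m ->
      all (fun x => x < l) v -> all (fun x => x < l) v' -> chi (wsub l v w) = chi (wsub l v' w)].
  move=> H; exists m => chi; exists (iota l m); split; rewrite ?size_iota //; first exact: rgw_iota.
  by move=> v v' h1 h2 h3 h4; rewrite (H v v').
case: k => [|k].
  by move=> m C; apply: triv => -[|x v] [|y v'].
elim: k => [|k IH] m C.
  apply: triv => v v' h h' al al'.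
  have E u : all (fun x => x < 1) u -> u = nseq (size u) 0.
    by move=> a; apply/all_pred1P; apply: sub_all a => -[].
  by rewrite (E _ al) (E _ al') h h'.
have [N1 H1] := IH m C; have [N H] := shelah_insensitive k N1 C.
exists N => chi; have [w1 [s1 r1 h1]] := H chi.
have [w2 [s2 r2 h2]] := H1 (fun y => chi (wsub k.+2 y w1)).
have a2 := rgw_lt r2.
(* In [w2] the letter [k.+1] is a parameter; the renaming makes it a constant. *)
pose w2' := wsub k.+1 (iota k.+2 m) w2.
have s2' : size w2' = N1 by rewrite size_wsub.
have r2' : rgw k.+2 (k.+2 + m) w2'.
  by apply: (rgw_wsub r2) => //; rewrite ?size_iota // rgw_iota.
exists (wsub k.+2 w2' w1); split; first by rewrite size_wsub.
  exact: rgw_wsub r1 s2' _ r2'.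
suff E v : size v = m -> all (fun x => x < k.+2) v ->
    chi (wsub k.+2 v (wsub k.+2 w2' w1)) = chi (wsub k.+2 (wsub k.+1 (map (minn k) v) w2) w1).
  move=> v v' sv sv' av av'; rewrite !E //; apply: h2; rewrite ?size_map //.
    by apply/allP => _ /mapP[x _ ->]; rewrite ltnS geq_minl.
  by apply/allP => _ /mapP[x _ ->]; rewrite ltnS geq_minl.
move=> sv av; rewrite wsub_assoc; last by rewrite s2'; exact: rgw_lt r1.
rewrite wsub_shift // h1 ?size_wsub //; first by rewrite wsub_flip // sv.
apply: wsub_all_lt => //; by rewrite ?sv.
Qed.

(** * From Hales-Jewett to dual Ramsey, by induction on the number of parameters *)

Lemma rgw_cons_new p h z : rgw 1 p.+1 h -> all (fun x => x < p.+2) z ->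
  rgw 1 p.+2 (h ++ p.+1 :: z).
Proof. by move=> hh az; apply: rgw_cat hh _; rewrite /= ltnn eqxx; exact: rgw_const. Qed.

(** A word is cut at its first [p.+1]: the head [h] has [p] parameters and the tail [z] is
    arbitrary, so Hales-Jewett applies to tails. With [j] coordinates frozen, one step treats the
    heads of length [j], all at once since they are finitely many, and the induction hypothesis
    treats the longer ones. *)
Lemma dual_ramsey_fusion p n : forall j (C : finType), exists N, forall chi : seq nat -> C,
  exists w, [/\ size w = N, rgw j.+1 (j.+1 + n) w &
    forall h z z', rgw 1 p.+1 h -> j <= size h -> size h + (size z).+1 = j + n ->
      size z' = size z -> all (fun x => x < p.+2) z -> all (fun x => x < p.+2) z' ->
      chi (wsub 1 (h ++ p.+1 :: z) (iota 1 j ++ w)) =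
      chi (wsub 1 (h ++ p.+1 :: z') (iota 1 j ++ w))].
Proof.
elim: n => [|n IH] j C.
  exists 0 => chi; exists [::]; split=> //=; first by rewrite addn0.
  move=> h z z' _ jh E; move: jh; rewrite leqNgt; case/negP.
  by rewrite -[j]addn0 -E addnS ltnS leq_addr.
have [N1 H1] := IH j.+1 C.
have [N HN] := hales_jewett j.+2 N1 {ffun j.-tuple 'I_p.+1 -> C}.
exists N.+1 => chi.
(* The [j.+2] letters name positions: 0 is the constant and [i > 0] stands for the [i]-th entry of
   [h']. The coloured words thus become independent of the head. *)
pose psi y : {ffun j.-tuple 'I_p.+1 -> C} := [ffun h : j.-tuple 'I_p.+1 =>
  let h' := rcons (map val h) p.+1 in chi (h' ++ map (nth 0 (0 :: h')) y)].
have [w1 [s1 r1 h1]] := HN psi.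
have [w2 [s2 r2 h2]] := H1 (fun v => chi (wsub 1 v (iota 1 j.+1 ++ w1))).
exists (j.+1 :: wsub j.+2 w2 w1); rewrite /= size_wsub s1 ltnn eqxx /=; split=> //.
  by rewrite addnS -addSn; apply: rgw_wsub r1 s2 _ r2.
have E0 : iota 1 j ++ j.+1 :: wsub j.+2 w2 w1 =
    wsub 1 (iota 1 j.+1 ++ w2) (iota 1 j.+1 ++ w1).
  have Ei u v : size u = j.+1 -> wsub 1 (u ++ v) (iota 1 j.+1) = u.
    by move=> <-; exact: wsub_iota.
  rewrite wsub_cat Ei ?size_iota // -[j.+1 :: _]cat1s catA; congr (_ ++ _).
  by rewrite -[X in _ = iota _ X]addn1 iotaD add1n.
have aw2 : all (fun x => x < 1 + (j + n.+1)) (iota 1 j.+1 ++ w2).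
  rewrite all_cat addSn addnS -addSn; apply/andP; split.
    by apply/allP => x; rewrite mem_iota => /andP[_ lt]; apply: leq_trans lt _; rewrite ltnS leq_addr.
  exact: rgw_lt r2.
have aw1 : all (fun x => x < 1 + size (iota 1 j.+1 ++ w2)) (iota 1 j.+1 ++ w1).
  rewrite size_cat size_iota s2 addnA all_cat; apply/andP; split; last exact: rgw_lt r1.
  by apply/allP => x; rewrite mem_iota => /andP[_ lt]; apply: leq_trans lt _; rewrite leq_addr.
move=> h z z' rh jh sz sz' az az'; rewrite E0.
have sh x : size x = size z -> size (h ++ p.+1 :: x) = j + n.+1.
  by move=> sx; rewrite size_cat /= sx.
rewrite !wsub_assoc //.
move: jh; rewrite leq_eqVlt => /orP[/eqP jh|jh]; last first.
  by apply: h2 => //; rewrite sz addSnnS.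
have sth : size (map (fun x => inord x : 'I_p.+1) h) == j by rewrite size_map -jh.
have Eh : map val (Tuple sth) = h.
  rewrite -map_comp -[RHS]map_id; apply/eq_in_map => x /(allP (rgw_lt rh)) /= lt.
  by rewrite inordK.
have key x : size x = size z -> all (fun y => y < p.+2) x ->
  exists zt, [/\ size zt = N1, all (fun y => y < j.+2) zt &
   chi (wsub 1 (wsub 1 (h ++ p.+1 :: x) (iota 1 j.+1 ++ w2)) (iota 1 j.+1 ++ w1)) =
   psi (wsub j.+2 zt w1) (Tuple sth)].
  move=> sx ax; set v := h ++ p.+1 :: x.
  pose h' := rcons h p.+1.
  have sh' : size h' = j.+1 by rewrite size_rcons -jh.
  have Ev : v = h' ++ x by rewrite /v /h' -cats1 -catA.
  have Eh' u : wsub 1 (h' ++ u) (iota 1 j.+1) = h' by rewrite -sh' wsub_iota.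
  have EV : wsub 1 v (iota 1 j.+1 ++ w2) = h' ++ wsub 1 v w2 by rewrite wsub_cat {1}Ev Eh'.
  have az2 : all (fun y => y < p.+2) (wsub 1 v w2).
    apply: wsub_all_lt => //.
      exact: (rgw_lt (rgw_cons_new rh ax)).
    by rewrite sh //; move: aw2; rewrite all_cat => /andP[].
  (* Every letter below [p.+2] occurs in [0 :: h'] and can be replaced by a position where it
     occurs. *)
  pose zt := map (index^~ (0 :: h')) (wsub 1 v w2).
  have mem y : y < p.+2 -> y \in 0 :: h'.
    case: y => [|y lt]; first by rewrite in_cons eqxx.
    rewrite in_cons mem_rcons in_cons; move: lt; rewrite ltnS leq_eqVlt.
    case/orP=> [->//|lt].
    by rewrite (rgw_mem rh) ?orbT.
  exists zt; split.
  - by rewrite size_map size_wsub.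
  - apply/allP => _ /mapP[y /(allP az2) lt ->].
    by have := mem _ lt; rewrite -index_mem /= sh'.
  rewrite /psi ffunE Eh -/h' EV wsub_cat Eh'.
  congr (chi (_ ++ _)).
  rewrite [in RHS]/wsub -map_comp {1}/wsub; apply/eq_in_map => y /(allP (rgw_lt r1)) lt.
  rewrite [iota 0 1 ++ _]catA nth_cat size_cat sh' add1n.
  case: (ltnP y j.+2) => [lt2|ge2]; first by rewrite /comp (wsub_nth_lo _ lt2).
  rewrite /comp -[in RHS](subnKC ge2) wsub_nth_hi.
  have lt3 : y - j.+2 < size w2 by rewrite s2 -(ltn_add2l j.+2) subnKC.
  have -> : nth 0 zt (y - j.+2) = index (nth 0 (wsub 1 v w2) (y - j.+2)) (0 :: h').
    by rewrite (nth_map 0) ?size_wsub.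
  rewrite nth_index //.
  by apply/mem/(allP az2)/mem_nth; rewrite size_wsub.
have [t [st at_ ->]] := key _ erefl az.
have [t' [st' at' ->]] := key _ sz' az'.
by rewrite (h1 t t').
Qed.

Definition dual_ramsey_prop p := forall m (C : finType), exists N, forall chi : seq nat -> C,
  exists w, [/\ size w = N, rgw 1 m.+1 w &
    forall v v', rgw 1 p.+1 v -> rgw 1 p.+1 v' -> size v = m -> size v' = m ->
      chi (wsub 1 v w) = chi (wsub 1 v' w)].

(** Once the colour depends only on the head, it is made to depend only on its length. The longest
    heads, with empty tail, are treated by the theorem for [p], which gives [w0]; the shorter ones
    by the induction hypothesis, the last letter then being immaterial. *)
Lemma dual_ramsey_level p (C : finType) : dual_ramsey_prop p -> forall m,
  exists N, forall chi : seq nat -> C,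
  (forall h z z', rgw 1 p.+1 h -> size h + (size z).+1 = N -> size z' = size z ->
     all (fun x => x < p.+2) z -> all (fun x => x < p.+2) z' ->
     chi (h ++ p.+1 :: z) = chi (h ++ p.+1 :: z')) ->
  exists w, [/\ size w = N, rgw 1 m.+1 w &
    forall h z h' z', rgw 1 p.+1 h -> rgw 1 p.+1 h' -> size h' = size h ->
     size h + (size z).+1 = m -> size z' = size z ->
     all (fun x => x < p.+2) z -> all (fun x => x < p.+2) z' ->
     chi (wsub 1 (h ++ p.+1 :: z) w) = chi (wsub 1 (h' ++ p.+1 :: z') w)].
Proof.
move=> IHp; elim=> [|m [n IH]].
  by exists 0 => chi _; exists [::].
have [N HN] := IHp n C; exists N.+1 => chi inv.
have [w0 [s0 r0 h0]] := HN (fun v => chi (rcons v p.+1)).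
have aw0 := rgw_lt r0.
have dec h z : rgw 1 p.+1 h -> size h + (size z).+1 = n -> all (fun x => x < p.+2) z ->
  exists x y, [/\ rgw 1 p.+1 x, size x + (size y).+1 = N, all (fun x => x < p.+2) y &
    wsub 1 (h ++ p.+1 :: z) w0 = x ++ p.+1 :: y] /\
    (forall z', size z' = size z -> all (fun x => x < p.+2) z' -> exists y',
      [/\ size y' = size y, all (fun x => x < p.+2) y' &
      wsub 1 (h ++ p.+1 :: z') w0 = x ++ p.+1 :: y']).
  move=> rh sz az.
  have [||x [y [E0 rx ry]]] := rgw_split r0 (e := (size h).+1) => //.
    by rewrite ltnS -sz addnS ltnS leq_addr.
  have E u : wsub 1 (h ++ p.+1 :: u) w0 = wsub 1 h x ++ p.+1 :: wsub 1 (h ++ p.+1 :: u) y.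
    rewrite E0 wsub_cat wsub_prefix; last first.
      by have := rgw_lt rx; rewrite -add1n.
    by rewrite /= nth_cat ltnn subnn.
  have ay u : size u = size z -> all (fun x => x < p.+2) u ->
      all (fun x => x < p.+2) (wsub 1 (h ++ p.+1 :: u) y).
    move=> su au; apply: wsub_all_lt => //; first exact: (rgw_lt (rgw_cons_new rh au)).
    by rewrite size_cat /= su sz; exact: rgw_lt ry.
  exists (wsub 1 h x), (wsub 1 (h ++ p.+1 :: z) y); split.
    split; rewrite ?E //; last exact: ay.
      by apply: (rgw_wsub (n := size h)) => //; rewrite add1n.
    by rewrite !size_wsub -s0 E0 size_cat /=.
  move=> z' sz' az'; exists (wsub 1 (h ++ p.+1 :: z') y).
  by rewrite !size_wsub E; split=> //; exact: ay.
have [|w [sw rw hw]] := IH (fun v => chi (rcons (wsub 1 v w0) 0)).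
  move=> h z z' rh sz sz' az az'.
  have [x [y [[rx sx ay ->] H]]] := dec _ _ rh sz az.
  have [y' [sy' ay' ->]] := H _ sz' az'.
  rewrite !rcons_cat !rcons_cons; apply: inv => //; rewrite ?size_rcons ?sy' ?all_rcons //.
  by rewrite addnS sx.
exists (rcons (wsub 1 w w0) m.+1); split; first by rewrite size_rcons size_wsub s0.
  rewrite -cats1; apply: (@rgw_cat _ m.+1); last by rewrite /= ltnn !eqxx.
  by apply: (rgw_wsub r0).
have aw := rgw_lt rw.
have Elast v l : size v = m -> wsub 1 (rcons v l) (rcons (wsub 1 w w0) m.+1) =
    rcons (wsub 1 (wsub 1 v w) w0) l.
  move=> sv; rewrite -!cats1 wsub_cat; congr (_ ++ _); last first.
    by rewrite /= nth_cat sv ltnn subnn.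
  rewrite wsub_assoc ?sw // wsub_prefix // ?sv //.
move=> h z h' z' rh rh' sh sz sz' az az'.
case: (lastP z) sz az sz' => [|{}z l]; last first.
  rewrite size_rcons !addnS => -[sz]; rewrite all_rcons => /andP[ll az].
  case: (lastP z') az' => [//|{}z' l'].
  rewrite size_rcons all_rcons => /andP[ll' az'] [sz'].
  rewrite -!rcons_cons -!rcons_cat !Elast; last first.
  - by rewrite size_cat /= addnS.
  - by rewrite size_cat /= addnS sh sz'.
  (* The last letter comes after the first [p.+1], so [inv] allows replacing it by 0. *)
  have norm u v q : rgw 1 p.+1 u -> all (fun x => x < p.+2) v -> q < p.+2 ->
      size u + size v = m.-1 -> 0 < m -> chi (rcons (wsub 1 (wsub 1 (u ++ p.+1 :: v) w) w0) q) =
      chi (rcons (wsub 1 (wsub 1 (u ++ p.+1 :: v) w) w0) 0).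
    move=> ru av lq sv m0.
    have suv : size u + (size v).+1 = m by rewrite addnS sv prednK.
    rewrite -wsub_assoc ?sw //.
    have r1 : rgw 1 m.+1 (wsub 1 w w0) by apply: (rgw_wsub r0).
    have [||x [y [E0 rx ry]]] := rgw_split r1 (e := (size u).+1) => //.
      by rewrite ltnS -suv addnS ltnS leq_addr.
    have S : size x + (size y).+1 = N by rewrite -s0 -(size_wsub 1 w w0) E0 size_cat.
    rewrite E0 wsub_cat /= nth_cat ltnn subnn wsub_prefix; last by have := rgw_lt rx; rewrite -add1n.
    have ay : all (fun x => x < p.+2) (wsub 1 (u ++ p.+1 :: v) y).
      apply: wsub_all_lt => //; first exact: (rgw_lt (rgw_cons_new ru av)).
      by rewrite size_cat /= suv; exact: rgw_lt ry.
    rewrite /= !rcons_cat !rcons_cons; apply: inv.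
    - by apply: (rgw_wsub (n := size u)) => //; rewrite add1n.
    - by rewrite size_rcons !size_wsub addnS S.
    - by rewrite !size_rcons.
    - by rewrite all_rcons lq.
    - by rewrite all_rcons ay.
  have m0 : 0 < m by rewrite -sz.
  rewrite (norm h) //; last by rewrite -sz.
  rewrite (norm h') //; last by rewrite -sz sh sz'.
  by apply: hw => //; rewrite -?sz ?addnS.
case: z' az' => // _ /=; rewrite addn1 => -[sz] _ _.
rewrite !cats1 !Elast ?sh //.
apply: h0; rewrite ?size_wsub //.
  by apply: (rgw_wsub rw).
by apply: (rgw_wsub rw) => //; rewrite sh.
Qed.

(** Used to select levels: after a substitution, a parameter can occur for the first time only at a
    marked position. *)
Lemma rgw_mask c (mk : seq bool) : 0 < c -> exists v, [/\ size v = size mk,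
  rgw c (c + count id mk) v & forall i, nth false mk i = false -> nth 0 v i < 1].
Proof.
elim: mk c => [|b mk IH] c c0.
  by exists [::]; split=> //= [|i _]; rewrite ?addn0 // nth_nil.
case: b.
  have [v [sv rv hv]] := IH c.+1 isT; exists (c :: v); split; rewrite /= ?sv //.
    by rewrite ltnn eqxx /= addnA addn1.
  by case.
have [v [sv rv hv]] := IH c c0; exists (0 :: v); split; rewrite /= ?sv ?c0 //.
by case=> [//|i /hv].
Qed.

Lemma dual_ramsey p : dual_ramsey_prop p.
Proof.
elim: p => [|p IH] m C.
  exists m => chi; exists (iota 1 m); split; [exact: size_iota | exact: rgw_iota |].
  move=> v v' r r' s s'; rewrite (_ : v = v') //.
  have E u : rgw 1 1 u -> u = nseq (size u) 0.
    by move/rgw_lt=> a; apply/all_pred1P; apply: sub_all a => -[].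
  by rewrite (E _ r) (E _ r') s s'.
(* With this many levels, some colour is taken on at least [m] of them. *)
pose m1 := #|C| * m.
have [n Hn] := dual_ramsey_level C IH m1.
have [N HN] := dual_ramsey_fusion p n 0 C; exists N => chi.
have [w1 [s1 r1 h1]] := HN chi.
have [|w2 [s2 r2 h2]] := Hn (fun v => chi (wsub 1 v w1)).
  by move=> h z z' rh sz sz' az az'; apply: h1.
have aw1 := rgw_lt r1; have aw2 := rgw_lt r2.
have [c0 hc0] : exists c0 : C, exists mk, [/\ size mk = m1, m <= count id mk &
    forall h z, rgw 1 p.+1 h -> size h + (size z).+1 = m1 -> all (fun x => x < p.+2) z ->
      nth false mk (size h) -> chi (wsub 1 (wsub 1 (h ++ p.+1 :: z) w2) w1) = c0].
  (* A default colour, for the levels too short to carry a head. *)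
  have c1 : C by exact: chi [::].
  have lev i : exists c : C, forall h z, size h = i -> rgw 1 p.+1 h ->
      size h + (size z).+1 = m1 -> all (fun x => x < p.+2) z ->
      chi (wsub 1 (wsub 1 (h ++ p.+1 :: z) w2) w1) = c.
    apply: contrapT => no.
    have [h [z [sh [rh [sz az]]]]] : exists h z, size h = i /\ rgw 1 p.+1 h /\
      size h + (size z).+1 = m1 /\ all (fun x => x < p.+2) z.
      apply: contrapT => no'; apply: no; exists c1 => h z sh rh sz az; case: no'.
      by exists h, z.
    apply: no; exists (chi (wsub 1 (wsub 1 (h ++ p.+1 :: z) w2) w1)) => h' z' sh' rh' sz' az'.
    apply: h2 => //; first by rewrite sh sh'.
    by apply/eqP; rewrite -(eqn_add2l (size h).+1) addSnnS sz sh -sh' addSnnS sz'.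
  have [f Hf] := choice lev.
  pose cnt c := count (fun i => f i == c) (iota 0 m1).
  have [c hc] : exists c, m <= cnt c.
    case: (posnP m) => [->|m0]; first by exists c1.
    apply: contrapT => no.
    have tot : \sum_(c : C) cnt c = m1.
      rewrite /cnt; transitivity (\sum_(i <- iota 0 m1) \sum_(c : C) (f i == c)).
        by rewrite exchange_big; apply: eq_bigr => c _; rewrite -sum1_count big_mkcond.
      rewrite (eq_bigr (fun=> 1)) ?sum1_size ?size_iota // => i _.
      by rewrite (bigD1 (f i)) //= eqxx big1 // => c; rewrite eq_sym => /negbTE->.
    have : m1 <= \sum_(c : C) m.-1.
      rewrite -tot; apply: leq_sum => c _; rewrite -ltnS prednK // ltnNge.
      by apply/negP => h; apply: no; exists c.
    rewrite sum_nat_const leq_pmul2l; first by rewrite leqNgt prednK // leqnn.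
    by apply/card_gt0P; exists c1.
  exists c, (map (fun i => f i == c) (iota 0 m1)); split.
  - by rewrite size_map size_iota.
  - by rewrite count_map.
  move=> h z rh sz az.
  have lt : size h < m1 by rewrite -sz addnS ltnS leq_addr.
  rewrite (nth_map 0) ?size_iota // nth_iota // add0n => /eqP<-.
  exact: Hf.
case: hc0 => mk0 [sm cm hm].
have [mk [smk cmk sub_mk]] : exists mk, [/\ size mk = m1, count id mk = m &
    forall i, nth false mk i -> nth false mk0 i].
  rewrite -sm; clear -cm; elim: mk0 m cm => [|b s IHs] m /=.
    by rewrite leqn0 => /eqP->; exists [::].
  case: m => [_|m cm].
    exists (false :: nseq (size s) false); split; rewrite /= ?size_nseq //.
      by rewrite count_nseq.
    by case=> [|i] //=; rewrite nth_nseq if_same.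
  case: b cm => cm.
    have [mk [h1 h2 h3]] := IHs m cm; exists (true :: mk); rewrite /= h1 h2.
    by split=> // -[].
  have [mk [h1 h2 h3]] := IHs m.+1 cm; exists (false :: mk); rewrite /= h1 h2.
  by split=> // -[].
(* The levels not chosen receive the constant 0, so the first [p.+1] of a substituted word is on a
   chosen level, where the colour is [c0]. *)
have [w3 [s3 r3 h3]] := rgw_mask mk (ltn0Sn 0).
rewrite add1n cmk in r3; rewrite smk in s3.
have aw3 := rgw_lt r3.
exists (wsub 1 (wsub 1 w3 w2) w1); split; first by rewrite size_wsub.
  by apply: (rgw_wsub r1); rewrite ?size_wsub //; apply: (rgw_wsub r2).
suff E v : rgw 1 p.+2 v -> size v = m -> chi (wsub 1 v (wsub 1 (wsub 1 w3 w2) w1)) = c0.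
  by move=> v v' r r' s s'; rewrite !E.
move=> rv sv.
rewrite wsub_assoc ?size_wsub ?s2 // wsub_assoc ?s3 //.
have rv3 : rgw 1 p.+2 (wsub 1 v w3) by apply: (rgw_wsub r3).
have [||x [y [E rx ry]]] := rgw_split rv3 (e := p.+1) => //.
have sxy : size x + (size y).+1 = m1 by rewrite -s3 -(size_wsub 1 v w3) E size_cat.
rewrite E; apply: hm => //; first exact: rgw_lt ry.
apply: sub_mk; case nk : (nth false mk (size x)) => //.
have := h3 _ nk; rewrite ltnS leqn0 => /eqP E3.
have lt : size x < size w3 by rewrite s3 -sxy addnS ltnS leq_addr.
have : nth 0 (wsub 1 v w3) (size x) = p.+1 by rewrite E nth_cat ltnn subnn.
by rewrite (nth_map 0) // E3.
Qed.

(** A word of length [m] has at most [m] parameters, so finitely many nested applications of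
    [dual_ramsey] suffice. *)
Lemma dual_ramsey_all m (C : finType) : exists N, forall chi : seq nat -> C,
  exists w, [/\ size w = N, rgw 1 m.+1 w &
    forall p v v', rgw 1 p.+1 v -> rgw 1 p.+1 v' -> size v = m -> size v' = m ->
      chi (wsub 1 v w) = chi (wsub 1 v' w)].
Proof.
have le p v : rgw 1 p.+1 v -> size v = m -> p < m.+1.
  move=> r s; rewrite ltnS -s -(size_iota 1 p); apply: uniq_leq_size; first exact: iota_uniq.
  by move=> x; rewrite mem_iota add1n => /andP[x0 xp]; exact: rgw_mem r x0 xp.
suff H q : exists N, forall chi : seq nat -> C,
  exists w, [/\ size w = N, rgw 1 m.+1 w &
    forall p v v', p < q -> rgw 1 p.+1 v -> rgw 1 p.+1 v' -> size v = m -> size v' = m ->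
      chi (wsub 1 v w) = chi (wsub 1 v' w)].
  have [N HN] := H m.+1; exists N => chi; have [w [s r h]] := HN chi; exists w; split=> //.
  by move=> p v v' rv rv' sv sv'; apply: (h p) => //; exact: le rv sv.
elim: q => [|q [N1 H1]].
  by exists m => chi; exists (iota 1 m); split; [exact: size_iota | exact: rgw_iota |].
have [N HN] := @dual_ramsey q N1 C; exists N => chi.
have [w1 [s1 r1 h1]] := HN chi.
have [w2 [s2 r2 h2]] := H1 (fun v => chi (wsub 1 v w1)).
exists (wsub 1 w2 w1); split; first by rewrite size_wsub.
  exact: (rgw_wsub r1).
move=> p v v' lt rv rv' sv sv'.
have aw1 := rgw_lt r1.
rewrite !wsub_assoc ?s2 //.
move: lt; rewrite ltnS leq_eqVlt => /orP[/eqP E|lt]; last by apply: (h2 p).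
by apply: h1; rewrite ?size_wsub //; apply: (rgw_wsub r2); rewrite // -?E.
Qed.

(** * Ramsey theorem for ordered hypergraphs *)

Lemma symmetric_rel_range n (I : Type) (Rel : ('I_n.+1 -> I) -> Prop) a b :
  symmetric_rel Rel -> injective a -> (forall i, exists j, a i = b j) -> Rel b -> Rel a.
Proof.
move=> sym inj /choice[f Hf] Rb.
have finj : injective f by move=> i j E; apply: inj; rewrite !Hf E.
have -> : a = (fun k => b (perm finj k)) by apply/funext => k; rewrite permE.
exact: sym.
Qed.

(** * Colexicographic order on finite sets *)

Section Colex.
Variable k : nat.
Implicit Types X Y Z : {set 'I_k}.

(** Two properties motivate this order: a set comes before its proper supersets, and the comparison
    is invariant under order isomorphisms between finite sets of points. *)
Definition colex X Y := [exists y, [&& y \in Y, y \notin X &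
  [forall z : 'I_k, (y < z) ==> ((z \in X) == (z \in Y))]]].

Lemma colexP X Y : reflect (exists y, [/\ y \in Y, y \notin X &
  forall z : 'I_k, y < z -> (z \in X) = (z \in Y)]) (colex X Y).
Proof.
apply: (iffP existsP) => -[y].
  by case/and3P=> h1 h2 /forallP h3; exists y; split=> // z; move/implyP: (h3 z) => H /H /eqP.
case=> h1 h2 h3; exists y; rewrite h1 h2; apply/forallP => z; apply/implyP => h.
by rewrite h3.
Qed.

Lemma colex_irr : irreflexive colex.
Proof. by move=> X; apply/colexP => -[y [->]]. Qed.

Lemma colex_trans : transitive colex.
Proof.
move=> Y X Z /colexP[y [yY yX hy]] /colexP[z [zZ zY hz]]; apply/colexP.
case: (ltngtP y z) => [lt|lt|/val_inj E].
- exists z; split=> // [|t lt2]; first by rewrite hy //.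
  by rewrite (hy _ (ltn_trans lt lt2)) hz.
- exists y; split=> // [|t lt2]; first by rewrite -hz //.
  by rewrite (hy _ lt2) (hz _ (ltn_trans lt lt2)).
by move: zY; rewrite -E yY.
Qed.

Lemma colex_top X Y : X != Y -> exists y, (y \in X) != (y \in Y) /\
  forall z : 'I_k, y < z -> (z \in X) = (z \in Y).
Proof.
move=> ne; have [y0 hy0] : exists y, (y \in X) != (y \in Y).
  apply/existsP; apply: contraNT ne => /existsPn h; apply/eqP/setP => y.
  by apply/eqP; rewrite -[_ == _]negbK h.
pose D := [pred y : 'I_k | (y \in X) != (y \in Y)].
case: (@arg_maxnP _ y0 D val hy0) => y Dy hy.
exists y; split=> // z lt; apply/eqP/negPn/negP => Dz.
by have := hy z Dz; rewrite /= leqNgt lt.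
Qed.

Lemma colex_total X Y : X != Y -> colex X Y || colex Y X.
Proof.
case/colex_top=> y [ne hy].
case yX : (y \in X) ne; case yY : (y \in Y) => // _; apply/orP; [right | left];
  apply/colexP; exists y; rewrite yX yY; split=> // z lt; by rewrite hy.
Qed.

Lemma colex_sub X Y : X \subset Y -> X != Y -> colex X Y.
Proof.
move=> /subsetP s /colex_top[y [ne hy]]; apply/colexP; exists y.
by have := s y; case: (y \in X) ne; case: (y \in Y) => // _ /(_ isT).
Qed.

Definition colex_sort (A : {set {set 'I_k}}) :=
  sort (fun X Y => (X == Y) || colex X Y) (enum A).

Lemma mem_colex_sort A X : (X \in colex_sort A) = (X \in A).
Proof. by rewrite mem_sort mem_enum. Qed.

Lemma colex_sort_sorted A : sorted colex (colex_sort A).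
Proof.
have u : uniq (colex_sort A) by rewrite sort_uniq enum_uniq.
have : sorted (fun X Y => (X == Y) || colex X Y) (colex_sort A).
  apply: sort_sorted => X Y; rewrite [Y == X]eq_sym; have [//|/colex_total] := eqVneq X Y.
  by case/orP=> ->; rewrite ?orbT.
case: (colex_sort A) u => //= X s /andP[].
elim: s X => //= Y s IH X; rewrite in_cons negb_or => /andP[/negbTE-> nX] /andP[nY u].
by case/andP=> /= -> /IH ->.
Qed.

Lemma colex_sorted_index s X Y : sorted colex s -> X \in s -> Y \in s -> colex X Y ->
  index X s < index Y s.
Proof.
move=> so Xs Ys lt; have [||E] := ltngtP (index X s) (index Y s) => //.
  move=> h; have := sorted_ltn_index colex_trans so _ _ Ys Xs h.
  by move/colex_trans/(_ lt); rewrite colex_irr.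
have XY : X = Y by rewrite -[X](nth_index X Xs) E nth_index.
by rewrite XY colex_irr in lt.
Qed.

End Colex.

(** * Traces of the basic family on a tuple, and the words they form *)

Section Trace.
Variables (n k : nat) (Rel : ('I_n.+1 -> 'I_k) -> Prop).
Hypothesis Rsym : symmetric_rel Rel.
Hypothesis Rinj : forall a, Rel a -> injective a.

Definition edge_set (X : {set 'I_k}) : bool :=
  `[< exists a, Rel a /\ X = [set a i | i : 'I_n.+1] >].

Lemma card_edge_set X : edge_set X -> #|X| = n.+1.
Proof. by case/asboolP=> a [/Rinj inj ->]; rewrite card_imset // card_ord. Qed.

Lemma edge_setP a : injective a -> edge_set [set a i | i : 'I_n.+1] <-> Rel a.
Proof.
move=> inj; split=> [/asboolP[b [Rb E]]|Ra]; last by apply/asboolP; exists a.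
apply: (symmetric_rel_range (b := b)) => // i.
have : a i \in [set a i | i : 'I_n.+1] by apply: imset_f.
by rewrite E => /imsetP[j _ ->]; exists j.
Qed.

(** A set of [n.+1] points lies in a member only if it is an edge, which prevents non-edges from
    becoming edges. *)
Definition basic_family := [set X : {set 'I_k} | (#|X| <= n) || edge_set X].

Lemma basic_family_sub (X X' : {set 'I_k}) : X' \subset X -> X \in basic_family -> X' \in basic_family.
Proof.
rewrite !inE => s; have [<- ->//|ne] := eqVneq X' X.
have := proper_card (A := mem X') (B := mem X); rewrite properEneq ne s => /(_ isT) lt.
case/orP=> [h|/card_edge_set E]; first by rewrite (leq_trans (ltnW lt) h).
by rewrite -ltnS -E lt.
Qed.

(** The empty set is set apart because it corresponds to the letter 0, the only constant; the other
    members correspond to the parameters. *)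
Definition basic_seq := colex_sort (basic_family :\ set0).
Definition basic_seq0 := set0 :: basic_seq.

Lemma basic_seq0_sorted : sorted (@colex k) basic_seq0.
Proof.
rewrite /= path_min_sorted ?colex_sort_sorted //; apply/allP => X.
by rewrite mem_colex_sort !inE => /andP[ne _]; apply: colex_sub; rewrite ?sub0set // eq_sym.
Qed.

Lemma mem_basic_seq0 X : (X \in basic_seq0) = (X \in basic_family).
Proof.
rewrite in_cons mem_colex_sort in_setD1; case: eqVneq => [->|//].
by rewrite inE cards0.
Qed.

Variables (m : nat).
Implicit Types u v : 'I_m -> 'I_k.

Definition trace u (X : {set 'I_k}) : {set 'I_m} := [set i | u i \in X].

(** Keeping only the members inside the range of [u] lists each trace once, at the smallest set that
    has it. *)
Definition trace_seq u : seq {set 'I_m} :=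
  [seq trace u X | X : {set 'I_k} <- basic_seq0 & X \subset [set u i | i : 'I_m]].

Lemma traceK u (X : {set 'I_k}) : X \subset [set u i | i : 'I_m] -> u @: trace u X = X.
Proof.
move=> /subsetP s; apply/setP => x; apply/imsetP/idP => [[i]|xS].
  by rewrite inE => h ->.
by have /imsetP[i _ E] := s x xS; exists i; rewrite // inE -E.
Qed.

Lemma traceI u X : trace u (X :&: [set u i | i : 'I_m]) = trace u X.
Proof. by apply/setP => i; rewrite !inE imset_f // andbT. Qed.

Lemma mem_trace_seq u T : (T \in trace_seq u) =
  (trace u (u @: T) == T) && (u @: T \in basic_family).
Proof.
apply/mapP/andP => [[X]|[/eqP E h]].
  rewrite mem_filter mem_basic_seq0 => /andP[s h ->]; by rewrite traceK.
exists (u @: T) => //; rewrite mem_filter mem_basic_seq0 h andbT.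
by apply: imsetS; apply/subsetP.
Qed.

Lemma trace_seq_head u : trace_seq u = set0 ::
  [seq trace u X | X : {set 'I_k} <- basic_seq & X \subset [set u i | i : 'I_m]].
Proof.
rewrite /trace_seq /= sub0set /=; congr (_ :: _).
by apply/setP => i; rewrite !inE.
Qed.

Lemma trace_in u X : X \in basic_seq0 -> trace u X \in trace_seq u.
Proof.
rewrite mem_basic_seq0 => h; rewrite -traceI mem_trace_seq traceK ?subsetIr // eqxx /=.
by apply: basic_family_sub h; rewrite subsetIl.
Qed.

Lemma trace_seq_sorted u :
  sorted (fun T T' : {set 'I_m} => colex (u @: T) (u @: T')) (trace_seq u).
Proof.
rewrite sorted_map (@eq_in_sorted _ [pred X : {set 'I_k} | X \subset [set u i | i : 'I_m]] _ (@colex k)).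
- by apply: sorted_filter basic_seq0_sorted; exact: colex_trans.
- by move=> X X' s s'; rewrite /= !traceK.
by apply/allP => X; rewrite mem_filter => /andP[].
Qed.

Definition trace_word u := [seq index (trace u X) (trace_seq u) | X <- basic_seq].

Lemma trace_word0 u : 0 :: trace_word u = [seq index (trace u X) (trace_seq u) | X <- basic_seq0].
Proof.
rewrite /trace_word [in RHS]/= {2}trace_seq_head /= (_ : trace u set0 = set0) ?eqxx //.
by apply/setP => i; rewrite !inE.
Qed.

(** A trace is first met at the member contained in the range of [u]: any other member with this
    trace contains it, hence comes later. So first occurrences follow the order of [trace_seq u]. *)
Lemma rgw_trace_word u : rgw 1 (size (trace_seq u)) (trace_word u).
Proof.
pose L := [seq X : {set 'I_k} <- basic_seq0 | X \subset [set u i | i : 'I_m]].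
have sL : size (trace_seq u) = size L by rewrite size_map.
have Lsub : subseq L basic_seq0 by apply: filter_subseq.
have u0 : uniq basic_seq0.
  by apply: (sorted_uniq (@colex_trans k) (@colex_irr k)); exact: basic_seq0_sorted.
have uL : uniq L by rewrite filter_uniq.
have uT : uniq (trace_seq u).
  rewrite map_inj_in_uniq // => X X'; rewrite !mem_filter => /andP[s _] /andP[s' _] E.
  by rewrite -(traceK s) E traceK.
have L0 : nth set0 L 0 = set0 by rewrite /L /= sub0set.
have nthL j : 0 < j -> j < size L -> [/\ nth set0 L j \in basic_seq,
    index (nth set0 L j) basic_seq \in [pred i | i < size basic_seq],
    nth set0 L j \subset [set u i | i : 'I_m] &
    index (trace u (nth set0 L j)) (trace_seq u) = j].
  move=> j0 jL; have := mem_nth set0 jL; rewrite mem_filter in_cons => /andP[s].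
  have ne : nth set0 L j != set0 by rewrite -[X in _ != X]L0 nth_uniq ?(leq_ltn_trans _ jL) // -lt0n.
  rewrite (negbTE ne) /= => h; split=> //; first by rewrite inE index_mem.
  have -> : trace u (nth set0 L j) = nth set0 (trace_seq u) j by rewrite (nth_map set0).
  by rewrite index_uniq // sL.
have first j : 0 < j -> j < size L -> index j (trace_word u) = index (nth set0 L j) basic_seq.
  move=> j0 jL; have [h1 h2 h3 h4] := nthL j j0 jL.
  set i0 := index _ basic_seq.
  have i0s : i0 < size (trace_word u) by rewrite size_map.
  have nth0 : nth 0 (trace_word u) i0 = j by rewrite (nth_map set0) // nth_index.
  apply/eqP; rewrite eqn_leq; apply/andP; split.
    rewrite leqNgt; apply/negP => lt.
    by have := before_find 0 lt; rewrite /= nth0 eqxx.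
  have jw : j \in trace_word u by rewrite -nth0 mem_nth.
  have := nth_index 0 jw; set i := index j _ => Ei.
  have is_ : i < size basic_seq by move: jw; rewrite -index_mem size_map.
  rewrite leqNgt; apply/negP => lt.
  move: Ei; rewrite (nth_map set0) // => Ei.
  set X := nth set0 basic_seq i in Ei.
  have Sb : X \in basic_seq by rewrite mem_nth.
  have Tr : trace u X = trace u (nth set0 L j).
    have T1 : trace u X \in trace_seq u by rewrite trace_in // in_cons Sb orbT.
    have T2 : trace u (nth set0 L j) \in trace_seq u by rewrite trace_in // in_cons h1 orbT.
    by rewrite -(nth_index set0 T1) -(nth_index set0 T2) Ei h4.
  have sub : nth set0 L j \subset X.
    by rewrite -(traceK h3) -Tr -traceI traceK ?subsetIr // subsetIl.
  have ub : uniq basic_seq by case/andP: u0.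
  have Ii : index X basic_seq = i by rewrite index_uniq.
  have [E|ne] := eqVneq (nth set0 L j) X.
    by move: lt; rewrite /i0 E Ii ltnn.
  have := colex_sorted_index (path_sorted basic_seq0_sorted) h1 Sb (colex_sub sub ne).
  by rewrite Ii ltnNge (ltnW lt).
apply: rgw_index.
- by rewrite trace_seq_head.
- apply/allP => _ /mapP[X Sb ->]; rewrite index_mem trace_in // in_cons Sb orbT //.
- move=> j /andP[j0 jL]; rewrite sL in jL; have [h1 h2 h3 h4] := nthL j j0 jL.
  by apply/mapP; exists (nth set0 L j).
move=> j j' /andP[j0 jj'] jL; rewrite sL in jL.
have jL0 := ltn_trans jj' jL; have j0' := ltn_trans j0 jj'.
rewrite !first //; have [h1 _ _ _] := nthL j j0 jL0; have [h1' _ _ _] := nthL j' j0' jL.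
apply: colex_sorted_index => //; first exact: path_sorted basic_seq0_sorted.
have so : sorted (@colex k) L by apply: sorted_filter basic_seq0_sorted; exact: colex_trans.
exact: (sorted_ltn_nth (@colex_trans k)).
Qed.

Lemma qf_lt_sym (J : Type) (lt : J -> J -> Prop) (u v : 'I_m -> J) :
  qf_eq_lt lt u v -> qf_eq_lt lt v u.
Proof. by case=> h1 h2; split=> i j; rewrite ?h1 ?h2. Qed.

Lemma qf_R_sym (J : Type) (Rl : ('I_n.+1 -> J) -> Prop) (u v : 'I_m -> J) :
  qf_R Rl u v -> qf_R Rl v u.
Proof. by move=> h s; rewrite h. Qed.

Lemma imset_mem_qf (u v : 'I_m -> 'I_k) (T : {set 'I_m}) (i : 'I_m) : (forall i j : 'I_m, u i = u j <-> v i = v j) ->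
  (u i \in u @: T) = (v i \in v @: T).
Proof. by move=> h; apply/imsetP/imsetP => -[j jT /h E]; exists j. Qed.

(** The lists are strictly sorted, and both the comparison of images and membership in the family
    depend only on the quantifier-free type. *)
Lemma trace_seq_eq u v : qf_eq_lt (fun x y : 'I_k => (x < y)%N) u v -> qf_R Rel u v ->
  trace_seq u = trace_seq v.
Proof.
suff [H1 H2] : (forall (u v : 'I_m -> 'I_k) (T T' : {set 'I_m}), qf_eq_lt (fun x y : 'I_k => (x < y)%N) u v ->
    colex (u @: T) (u @: T') -> colex (v @: T) (v @: T')) /\
  (forall (u v : 'I_m -> 'I_k) (T : {set 'I_m}), qf_eq_lt (fun x y : 'I_k => (x < y)%N) u v -> qf_R Rel u v ->
    T \in trace_seq u -> T \in trace_seq v).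
  move=> q r; have tr w : transitive (fun T T' : {set 'I_m} => colex (w @: T) (w @: T')).
    by move=> T1 T2 T3; exact: colex_trans.
  apply: (irr_sorted_eq (tr _ u)); rewrite ?trace_seq_sorted //.
  - by move=> T; exact: colex_irr.
  - rewrite (@eq_sorted _ _ (fun T T' : {set 'I_m} => colex (v @: T) (v @: T'))) ?trace_seq_sorted //.
    by move=> T T'; apply/idP/idP; apply: H1 => //; exact: qf_lt_sym.
  by move=> T; apply/idP/idP; apply: H2 => //; [exact: qf_lt_sym | exact: qf_R_sym].
split=> {}u {}v T.
  move=> T' [q1 q2] /colexP[_ [/imsetP[i iT' ->] ni hi]]; apply/colexP; exists (v i); split.
  - exact: imset_f.
  - by rewrite -(imset_mem_qf T i q1).
  move=> z lt; have [/imsetP[j _ E]|no] := boolP (z \in [set v i | i : 'I_m]).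
    by rewrite E -!(imset_mem_qf _ j q1); apply: hi; apply/q2; rewrite -E.
  have nz (A : {set 'I_m}) : (z \in v @: A) = false.
    by apply: contraNF no; apply/subsetP/imsetS/subsetP.
  by rewrite !nz.
move=> [q1 q2] r; rewrite !mem_trace_seq => /andP[/eqP h1 h2]; apply/andP; split.
  by apply/eqP; rewrite -[RHS]h1; apply/setP => i; rewrite !inE (imset_mem_qf T i q1).
move: h2; rewrite !inE => /orP[le|/asboolP[a [Ra E]]]; apply/orP.
  left; apply: leq_trans le.
  (* [u] need not be injective; as [v] factors through it, images under [v] are no larger. *)
  have [f Hf] : exists f, forall t, v t = f (u t).
    have /choice[f Hf] : forall x, exists y, forall t, u t = x -> v t = y.
      move=> x; case: (pselect (exists t, u t = x)) => [[t0 <-]|no].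
        by exists (v t0) => t /q1.
      by exists x => t E; case: no; exists t.
    by exists f => t; apply: Hf.
  have -> : v @: T = f @: (u @: T).
    by rewrite -imset_comp; apply: eq_imset => t; rewrite Hf.
  exact: leq_imset_card.
have /choice[s Hs] : forall i, exists t, t \in T /\ a i = u t.
  move=> i; have : a i \in u @: T by rewrite E imset_f.
  by case/imsetP=> t tT ->; exists t.
right; apply/asboolP; exists (fun i => v (s i)); split.
  apply/(r s); have <- // : a = (fun i => u (s i)).
  by apply/funext => i; case: (Hs i).
apply/setP => x; apply/imsetP/imsetP => [[t tT ->]|[i _ ->]]; last first.
  by exists (s i) => //; case: (Hs i).
have : u t \in u @: T by apply: imset_f.
rewrite E => /imsetP[i _ Ei]; exists i => //; apply/q1; rewrite Ei.
by case: (Hs i).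
Qed.

End Trace.

(* A vertex [b] is coded by the 0/1 word marking the coordinates [t] whose set
   contains [b]; vertices form an edge iff some coordinate marks all of them. *)
Theorem ordered_hypergraph_ramsey n k (Rel : ('I_n.+1 -> 'I_k) -> Prop) :
  symmetric_rel Rel -> (forall a, Rel a -> injective a) ->
  forall (s : nat) (m : 'I_s -> nat) (u v : forall l, 'I_(m l) -> 'I_k) (C : finType),
  (forall l, qf_eq_lt (fun x y : 'I_k => (x < y)%N) (u l) (v l) /\ qf_R Rel (u l) (v l)) ->
  exists N, forall col : forall l, ('I_(m l) -> {ffun 'I_N -> bool}) -> C,
  exists x : 'I_k -> {ffun 'I_N -> bool},
    (forall a, injective a -> (Rel a <-> exists t, forall i, x (a i) t)) /\
    (forall l, col l (fun i => x (u l i)) = col l (fun i => x (v l i))).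
Proof.
move=> Rsym Rinj s m u v C huv.
have [N HN] := dual_ramsey_all (size (basic_seq Rel)) {ffun 'I_s -> C}.
exists N => col.
(* A word [y] is read as a sequence of subsets of the index set of the tuple: coordinate [t] of the
   [i]-th vertex tells whether [i] belongs to the [t]-th subset. *)
have [w [sw rw hw]] := HN (fun y => [ffun l => col l (fun i =>
  [ffun t : 'I_N => i \in nth set0 (trace_seq Rel (u l)) (nth 0 y t)])]).
have lw (t : 'I_N) : nth 0 w t < size (basic_seq0 Rel).
  by apply: (allP (rgw_lt rw)); rewrite mem_nth // sw.
(* Coordinate [t] carries the member numbered [nth 0 w t]. All parameters occur in [w], so every
   edge is carried by some coordinate. *)
exists (fun b => [ffun t : 'I_N => b \in nth set0 (basic_seq0 Rel) (nth 0 w t)]); split.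
  move=> a inj; split=> [Ra|[t ht]].
    have eb : [set a i | i : 'I_n.+1] \in basic_seq0 Rel.
      by rewrite mem_basic_seq0 inE (edge_setP Rsym inj).2 ?orbT.
    have : index [set a i | i : 'I_n.+1] (basic_seq0 Rel) \in w.
      apply: (rgw_mem rw); last by rewrite ltnS; move: eb; rewrite -index_mem.
      rewrite /= ifN //; apply/negP => /eqP E.
      have : a ord0 \in [set a i | i : 'I_n.+1] by apply: imset_f.
      by rewrite -E inE.
    case/(nthP 0)=> t tw Et; rewrite sw in tw; exists (Ordinal tw) => i.
    by rewrite ffunE Et nth_index // imset_f.
  have := mem_nth set0 (lw t); set X := nth _ _ _ => Sb.
  have sub : [set a i | i : 'I_n.+1] \subset X.
    by apply/subsetP => _ /imsetP[i _ ->]; have := ht i; rewrite ffunE.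
  have ca : #|[set a i | i : 'I_n.+1]| = n.+1 by rewrite card_imset // card_ord.
  move: Sb; rewrite mem_basic_seq0 inE => /orP[le|eS].
    by have := leq_trans (subset_leq_card sub) le; rewrite ca ltnn.
  apply/(edge_setP Rsym inj); have /eqP-> // : [set a i | i : 'I_n.+1] == X.
  by rewrite eqEcard sub ca (card_edge_set Rinj) // leqnn.
(* Seen from the tuple [y], the sets carried by the coordinates become their traces, and these are
   the letters of [trace_word Rel y] substituted in [w]. *)
have E l (y : 'I_(m l) -> 'I_k) : trace_seq Rel (u l) = trace_seq Rel y ->
   col l (fun i => [ffun t : 'I_N => y i \in nth set0 (basic_seq0 Rel) (nth 0 w t)]) =
   col l (fun i => [ffun t : 'I_N =>
     i \in nth set0 (trace_seq Rel (u l)) (nth 0 (wsub 1 (trace_word Rel y) w) t)]).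
  move=> Et; congr (col l); apply/funext => i; apply/ffunP => t; rewrite !ffunE.
  rewrite (nth_map 0) ?sw // [iota 0 1 ++ _](trace_word0 Rel y) (nth_map set0) //.
  rewrite Et nth_index ?inE //; apply: (trace_in Rinj); exact: mem_nth.
move=> l; have [h1 h2] := huv l; have Etr := trace_seq_eq h1 h2.
rewrite (E l (u l)) // (E l (v l)) //.
have p0 : 0 < size (trace_seq Rel (u l)) by rewrite trace_seq_head.
have r1 := rgw_trace_word Rinj (u l); have r2 := rgw_trace_word Rinj (v l).
rewrite -Etr -(prednK p0) in r2; rewrite -(prednK p0) in r1.
have := hw _ _ _ r1 r2; rewrite !size_map => /(_ erefl erefl).
by move/(congr1 (fun f : {ffun _} => f l)); rewrite !ffunE.
Qed.

(** * Formulas and limits along ultrafilters *)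

Import Order.TTheory GRing.Theory Num.Theory.
Local Open Scope ring_scope.
Local Open Scope classical_set_scope.

Lemma isFormula_bounds (M : cstruct) : is_cstruct M -> forall (V : finType) (phi : (V -> M) -> R),
  isFormula phi -> forall e, 0 <= phi e <= 1.
Proof.
case=> [[x0] [hd [_ [_ [_ [_ [hp _]]]]]]] V phi; elim=> {V phi} /=.
- by move=> V p ts _ e.
- by move=> V t1 t2 _ _ e.
- by move=> V m u phis [hu _] _ IH e; apply: hu => i; exact: IH.
- move=> V phi _ IH e; apply/andP; split.
    apply: (le_trans (y := phi (ext e x0))); first by case/andP: (IH (ext e x0)).
    apply: ub_le_sup; last by exists x0.
    by exists 1 => _ [a _ <-]; case/andP: (IH (ext e a)).
  apply: ge_sup; first by exists (phi (ext e x0)), x0.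
  by move=> _ [a _ <-]; case/andP: (IH (ext e a)).
move=> V phi _ IH e; apply/andP; split.
  apply: lb_le_inf; first by exists (phi (ext e x0)), x0.
  by move=> _ [a _ <-]; case/andP: (IH (ext e a)).
apply: (le_trans (y := phi (ext e x0))); last by case/andP: (IH (ext e x0)).
apply: ge_inf; last by exists x0.
by exists 0 => _ [a _ <-]; case/andP: (IH (ext e a)).
Qed.

Lemma isTerm_rename (M : cstruct) (V W : finType) (rho : V -> W) (t : (V -> M) -> M) :
  isTerm t -> isTerm (fun e : W -> M => t (e \o rho)).
Proof.
elim=> [v|f ts _ IH] /=; first exact: tVar.
exact: (@tFun M W f (fun i e => ts i (e \o rho)) IH).
Qed.

Lemma isFormula_rename (M : cstruct) (V : finType) (phi : (V -> M) -> R) :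
  isFormula phi -> forall (W : finType) (rho : V -> W), isFormula (fun e : W -> M => phi (e \o rho)).
Proof.
have E (V' W : finType) (rho : V' -> W) (psi : (option V' -> M) -> R) (e : W -> M) :
    (fun a => psi (ext (e \o rho) a)) = (fun a => psi (ext e a \o omap rho)).
  by apply/funext => a; congr psi; apply/funext => -[].
elim=> {V phi} /=.
- move=> V p ts hts W rho; have H i := isTerm_rename rho (hts i).
  exact: (fPred H).
- by move=> V t1 t2 h1 h2 W rho; exact: (fDist (isTerm_rename rho h1) (isTerm_rename rho h2)).
- move=> V m u phis hu _ IH W rho; have H i := IH i W rho.
  exact: (fConn hu H).
- move=> V phi _ IH W rho.
  rewrite (_ : (fun e => _) = (fun e : W -> M => sup (range (fun a => phi (ext e a \o omap rho))))).
    exact: fSup (IH _ (omap rho)).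
  by apply/funext => e; rewrite E.
move=> V phi _ IH W rho.
rewrite (_ : (fun e => _) = (fun e : W -> M => inf (range (fun a => phi (ext e a \o omap rho))))).
  exact: fInf (IH _ (omap rho)).
by apply/funext => e; rewrite E.
Qed.

(** The conditions in [saturated] are equations with 0; the vanishing of this connective expresses
    [|y - L| <= eps]. *)
Definition excess (L eps : R) (y : 'I_1 -> R) : R := Num.max 0 (`|y ord0 - L| - eps).

Lemma connective_excess L eps : 0 <= L <= 1 -> 0 <= eps -> connective (excess L eps).
Proof.
move=> /andP[L0 L1] e0; split=> [y hy|x _ e he].
  rewrite /excess le_max lexx /= ge_max ler01 /=.
  have /andP[h0 h1] := hy ord0.
  have : `|y ord0 - L| <= 1 by rewrite ler_norml; apply/andP; split; lra.
  lra.
exists e; split=> // y _ h; apply: le_lt_trans (h ord0); rewrite /excess.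
have H : `| `|x ord0 - L| - `|y ord0 - L| | <= `|x ord0 - y ord0|.
  by apply: le_trans (ler_dist_dist _ _) _; rewrite opprB addrA subrK.
have N := normr_ge0 (x ord0 - y ord0).
move: H; rewrite !ler_norml => /andP[H1 H2]; apply/andP; split.
  by case: (leP 0 (`|x ord0 - L| - eps)) => ?; case: (leP 0 (`|y ord0 - L| - eps)) => ?; lra.
by case: (leP 0 (`|x ord0 - L| - eps)) => ?; case: (leP 0 (`|y ord0 - L| - eps)) => ?; lra.
Qed.

(** A conjunction of finitely many approximate equalities. The mean stays between 0 and 1 and
    controls each deviation up to the factor [m]. *)
Definition mean_dev m (L y : 'I_m -> R) : R := (\sum_i `|y i - L i|) / m%:R.

Lemma mean_dev_le m (L y : 'I_m -> R) d : 0 <= d -> (forall i, `|y i - L i| <= d) ->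
  mean_dev L y <= d.
Proof.
case: m L y => [|m] L y d0 h; first by rewrite /mean_dev invr0 mulr0.
rewrite /mean_dev ler_pdivrMr ?ltr0n //.
apply: le_trans (ler_sum _ (fun i _ => h i)) _.
by rewrite sumr_const card_ord mulr_natr.
Qed.

Lemma mean_dev_ge0 m (L y : 'I_m -> R) : 0 <= mean_dev L y.
Proof. by rewrite /mean_dev mulr_ge0 ?invr_ge0 ?ler0n // sumr_ge0. Qed.

Lemma le_mean_dev m (L y : 'I_m -> R) i : `|y i - L i| <= m%:R * mean_dev L y.
Proof.
case: m L y i => [|m] L y i; first by case: i.
rewrite /mean_dev mulrCA divff ?pnatr_eq0 // mulr1 (bigD1 i) //=.
by rewrite lerDl sumr_ge0.
Qed.

Lemma connective_mean_dev m (L : 'I_m -> R) : (forall i, 0 <= L i <= 1) ->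
  connective (mean_dev L).
Proof.
move=> hL; split=> [y hy|x _ e he].
  rewrite mean_dev_ge0 /=; apply: mean_dev_le => // i.
  have /andP[h0 h1] := hy i; have /andP[L0 L1] := hL i.
  by rewrite ler_norml; apply/andP; split; lra.
exists (e / 2); split=> [|y _ h]; first by rewrite divr_gt0.
apply: (@le_lt_trans _ _ (e / 2)); last by lra.
rewrite /mean_dev -mulrBl -sumrB.
have h2 : \sum_i `| `|x i - L i| - `|y i - L i| | / m%:R <= e / 2.
  case: m L hL x y h => [|m] L hL x y h.
    by rewrite big_ord0 divr_ge0 // ltW.
  rewrite -mulr_suml ler_pdivrMr ?ltr0n //.
  apply: (@le_trans _ _ (\sum_(i < m.+1) (e / 2))); last by rewrite sumr_const card_ord mulr_natr.
  apply: ler_sum => i _; apply: le_trans (ler_dist_dist _ _) _.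
  by rewrite opprB addrA subrK ltW.
apply: le_trans h2; rewrite normrM (ger0_norm (x := m%:R^-1)) ?invr_ge0 ?ler0n // -mulr_suml.
apply: ler_wpM2r; first by rewrite invr_ge0 ler0n.
exact: ler_norm_sum.
Qed.

Lemma min_pos m (eps : 'I_m -> R) : (forall i, 0 < eps i) ->
  exists d, 0 < d /\ forall i, d <= eps i.
Proof.
move=> h; exists (\big[Num.min/1]_i eps i); split; first exact: lt_bigmin.
by move=> i; exact: bigmin_le.
Qed.

Section UltraLimits.
Variables (E : Type) (U : set_system E).
Hypothesis UU : UltraFilter U.

Lemma ultra_ex (X : set E) : U X -> exists e, X e.
Proof.
move=> UX; have PF : ProperFilter U by apply: ultra_proper.
by have [e] := filter_ex UX; exists e.
Qed.

Lemma ultraI (X Y : set E) : U X -> U Y -> U (fun e => X e /\ Y e).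
Proof.
have PF : ProperFilter U by apply: ultra_proper.
exact: filterI.
Qed.

Lemma ultraS (X Y : set E) : U X -> (forall e, X e -> Y e) -> U Y.
Proof.
have PF : ProperFilter U by apply: ultra_proper.
by move=> UX h; apply: filterS h UX.
Qed.

Lemma ultra_forall m (X : 'I_m -> set E) : (forall i, U (X i)) -> U (fun e => forall i, X i e).
Proof.
have PF : ProperFilter U by apply: ultra_proper.
move=> h; suff H k : U (fun e => forall i : 'I_m, (i < k)%N -> X i e).
  by apply: ultraS (H m) _ => e he i; apply: he.
elim: k => [|k IH]; first by apply: ultraS filterT _ => e _ i.
case: (ltnP k m) => [km|mk].
  apply: ultraS (ultraI IH (h (Ordinal km))) _ => e [h1 h2] i.
  rewrite ltnS leq_eqVlt => /orP[/eqP Ei|]; last exact: h1.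
  by rewrite (_ : i = Ordinal km) //; apply: val_inj.
apply: ultraS IH _ => e h1 i _; apply: h1; exact: leq_trans (ltn_ord i) mk.
Qed.

Lemma ultra_lim (F : E -> R) : (forall e, 0 <= F e <= 1) ->
  exists L, 0 <= L <= 1 /\ forall eps, 0 < eps -> U (fun e => `|F e - L| < eps).
Proof.
have PF : ProperFilter U by apply: ultra_proper.
move=> F01; pose S : set R := [set t | 0 <= t /\ U (fun e => t <= F e)].
have S0 : S 0 by split=> //; apply: ultraS filterT _ => e _; case/andP: (F01 e).
have Sub : ubound S 1.
  move=> t [_ /ultra_ex[e h]]; apply: le_trans h _; by case/andP: (F01 e).
have hS : has_sup S by split; [exists 0 | exists 1].
have s0 : 0 <= sup S by apply: ub_le_sup => //; case: hS.
exists (sup S); split; first by rewrite s0 /=; apply: ge_sup => //; exists 0.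
move=> eps e0; have [t [t0 Ut] lt] := sup_adherent e0 hS.
have e2 : 0 < eps / 2 by rewrite divr_gt0.
have [Uge|Ult] := in_ultra_setVsetC (fun e => sup S + eps / 2 <= F e) UU.
  have : sup S + eps / 2 <= sup S.
    by apply: ub_le_sup; [case: hS|split=> //; lra].
  lra.
apply: ultraS (ultraI Ut Ult) _ => e [h1 /negP]; rewrite -ltNge => h2.
by rewrite ltr_norml; apply/andP; split; lra.
Qed.

End UltraLimits.

(** * Indiscernible sequences from IP *)

Lemma small_countable (M : cstruct) (K : Type) : countable_type K -> small M K.
Proof.
case=> f inj; exists (fun x => ((f x)%:R, None)) => x y [E].
by apply: inj; apply/eqP; rewrite -(eqr_nat R) E.
Qed.

(** * Realizing an ultrafilter limit by saturation, one variable at a time *)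

Section Realize.
Variables (M : cstruct) (J : Type) (code : J -> nat) (U : set_system (J -> M)).
Hypotheses (MM : monster M) (code_inj : injective code) (UU : UltraFilter U).

(** Only the values of [p] at indices of code below [k] matter. *)
Definition realizes (k : nat) (p : J -> M) := forall (W : finType) (phi : (W -> M) -> R) (h : W -> J),
  isFormula phi -> (forall w, (code (h w) < k)%N) ->
  forall eps, 0 < eps -> U (fun e => `|phi (e \o h) - phi (p \o h)| < eps).

Record goal (k : nat) := Goal {
  gW : finType; gphi : (gW -> M) -> R; gh : gW -> J; geps : R;
  gform : isFormula gphi; gcode : forall w, (code (gh w) <= k)%N; geps_gt0 : 0 < geps }.

Definition upd (p : J -> M) (j : J) (x : M) : J -> M := fun i => if `[< i = j >] then x else p i.

(** The infimum [psi] of the mean deviation over the missing variable involves only indices already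
    realized. It is small at most [e], with [e j0] as witness, hence small at [p]. *)
Lemma realizes_finite k p j0 m (q : 'I_m -> goal k) (L : 'I_m -> R) :
  realizes k p -> code j0 = k -> (forall i, 0 <= L i <= 1) ->
  (forall i eps, 0 < eps -> U (fun e => `|gphi (e \o gh (g:=q i)) - L i| < eps)) ->
  exists x, forall i, `|gphi (upd p j0 x \o gh (g:=q i)) - L i| <= geps (q i).
Proof.
have [Mst _] := MM.
move=> hp cj0 hL hU.
(* The variables of all goals are gathered in one type; those sent to [j0] become the quantified
   variable [None], the others form [Z]. *)
pose T : finType := {i : 'I_m & gW (q i)}.
pose H (z : T) : J := gh (tagged z).
pose Z : finType := {z : T | ~~ `[< H z = j0 >]}.
pose rho i (w : gW (q i)) : option Z := insub (Tagged (fun i => gW (q i)) w).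
pose theta (e : option Z -> M) : R := mean_dev L (fun i => gphi (e \o @rho i)).
pose psi (e : Z -> M) : R := inf (range (fun a => theta (ext e a))).
have ftheta : isFormula theta.
  apply: (fConn (connective_mean_dev hL)) => i; apply: isFormula_rename; exact: gform.
have fpsi : isFormula psi := fInf ftheta.
pose hZ (z : Z) : J := H (val z).
have rhoE (e : J -> M) i : ext (e \o hZ) (e j0) \o @rho i = e \o gh (g := q i).
  apply/funext => w; rewrite /= /rho; case: insubP => [z _ Ez|].
    by rewrite /= /hZ Ez.
  by rewrite negbK => /asboolP E; exact: (congr1 e (esym E)).
have rhoE' (x : M) i : ext (p \o hZ) x \o @rho i = upd p j0 x \o gh (g := q i).
  apply/funext => w; rewrite /= /rho /upd; case: insubP => [z|].
    by move=> /negbTE hz Ez; rewrite /= /hZ Ez; rewrite /H /= in hz; rewrite hz.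
  by rewrite negbK /H /= => ->.
have [d [d0 hd]] := min_pos (fun i => geps_gt0 (q i)).
(* The three [e0] account for the deviation at [e], the passage from [e] to [p], and an almost
   optimal [x]. The factor [m.+1] turns the mean into single deviations and is positive even without
   goals. *)
pose e0 := d / (3 * m.+1%:R).
have m0 : 0 < m.+1%:R :> R by rewrite ltr0n.
have e00 : 0 < e0 by rewrite divr_gt0 // mulr_gt0.
have codeZ z : (code (hZ z) < k)%N.
  rewrite ltn_neqAle (gcode (tagged (val z))) andbT; apply/negP => /eqP E.
  have := valP z; move/negP; apply; apply/asboolP; apply: code_inj.
  by rewrite -/(hZ z) E cj0.
have U1 := hp Z psi hZ fpsi codeZ e0 e00.
have U2 := ultra_forall UU (fun i => hU i e0 e00).
have [e [he1 he2]] := ultra_ex UU (ultraI UU U1 U2).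
have lbt (e' : Z -> M) : has_lbound (range (fun a => theta (ext e' a))).
  by exists 0 => _ [a _ <-]; exact: mean_dev_ge0.
have psi_e : psi (e \o hZ) <= e0.
  apply: (@le_trans _ _ (theta (ext (e \o hZ) (e j0)))).
    by apply: ge_inf => //; exists (e j0).
  rewrite /theta; apply: mean_dev_le; first exact: ltW.
  by move=> i; rewrite rhoE; exact: ltW.
have psi_p : psi (p \o hZ) < 2 * e0.
  move: he1; rewrite ltr_norml => /andP[h1 h2]; lra.
have hi : has_inf (range (fun a => theta (ext (p \o hZ) a))).
  by split; [exists (theta (ext (p \o hZ) (p j0))), (p j0) | exact: lbt].
have [_ [x _ <-] hx] := inf_adherent e00 hi.
exists x => i.
have := le_mean_dev L (fun i => gphi (ext (p \o hZ) x \o @rho i)) i.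
rewrite rhoE' => h; apply: le_trans h _; apply: le_trans (hd i).
have th : theta (ext (p \o hZ) x) <= 3 * e0 by move: hx; rewrite -/(psi _) => hx; lra.
apply: (@le_trans _ _ (m%:R * (3 * e0))).
  by apply: ler_wpM2l th; rewrite ler0n.
apply: (@le_trans _ _ (m.+1%:R * (3 * e0))).
  by apply: ler_wpM2r; [lra | rewrite ler_nat].
rewrite /e0 le_eqVlt; apply/orP; left; apply/eqP.
by field; rewrite -natr1 addrC in m0; rewrite lt0r_neq0.
Qed.

(** The parameters are the countably many values of [p]. Each goal carries a tolerance, which makes
    the conditions finitely satisfiable; all tolerances together give the exact limits. *)
Lemma realizes_step k p : realizes k p ->
  exists p', realizes k.+1 p' /\ forall j, (code j < k)%N -> p' j = p j.
Proof.
have [Mst [sat _]] := MM; move=> hp.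
case: (pselect (exists j, code j = k)) => [[j0 cj0]|no]; last first.
  exists p; split=> // W phi h fphi hc; apply: hp => // w.
  have := hc w; rewrite ltnS leq_eqVlt => /orP[/eqP E|//].
  by case: no; exists (h w).
have bnd := isFormula_bounds Mst.
have /choice[L HL] (q : goal k) : exists L, 0 <= L <= 1 /\
    forall eps, 0 < eps -> U (fun e => `|gphi (e \o gh (g := q)) - L| < eps).
  by apply: ultra_lim => // e; apply: bnd; exact: gform.
pose Sg (q : goal k) : condition M := Cond
  (fun e : option (gW q) -> M => excess (L q) (geps q) (fun _ : 'I_1 =>
    gphi (e \o (fun w => if `[< gh w = j0 >] then None else Some w))))
  (fun w => p (gh w)).
have E (q : goal k) x : ext (fun w => p (gh w)) x \o
    (fun w : gW q => if `[< gh w = j0 >] then None else Some w) = upd p j0 x \o gh (g := q).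
  by apply/funext => w; rewrite /= /upd; case: asboolP.
have satE q x : cond_sat (Sg q) x <-> `|gphi (upd p j0 x \o gh (g := q)) - L q| <= geps q.
  rewrite /cond_sat /Sg /= E /excess; split.
    by move/eqP; rewrite eq_maxl subr_le0.
  by rewrite -subr_le0 => h; apply/eqP; rewrite eq_maxl.
have smallA : small M {x : M | exists j, p j = x}.
  apply: small_countable.
  have /choice[f Hf] : forall x : {x : M | exists j, p j = x}, exists j, p j = sval x by case.
  exists (fun x => code (f x)) => x y /code_inj E'.
  apply: eq_sig_hprop; first by move=> z; exact: Prop_irrelevance.
  by rewrite -[LHS]Hf -[RHS]Hf E'.
have [||x Hx] := sat (fun x => exists j, p j = x) smallA (goal k) Sg.
- move=> q; split; last by move=> v; exists (gh v).
  apply: (@fConn M _ 1 _ (fun _ e => gphi (e \o (fun w => if `[< gh w = j0 >] then None else Some w)))).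
    by apply: connective_excess; [case: (HL q) | exact: ltW (geps_gt0 q)].
  by move=> _; apply: isFormula_rename; exact: gform.
- move=> m g; have [||x Hx] := @realizes_finite k p j0 m g (fun i => L (g i)) hp cj0.
  + by move=> i; case: (HL (g i)).
  + by move=> i; case: (HL (g i)).
  by exists x => i; apply/satE.
exists (upd p j0 x); split; last first.
  move=> j lt; rewrite /upd; case: asboolP => // Ej.
  by move: lt; rewrite Ej cj0 ltnn.
move=> W phi h fphi hc eps e0.
have hc' w : (code (h w) <= k)%N by rewrite -ltnS.
have e2 : 0 < eps / 2 by rewrite divr_gt0.
pose q := @Goal k W phi h (eps / 2) fphi hc' e2.
have /satE Hq := Hx q; have [_ /(_ _ e2) Uq] := HL q.
apply: ultraS UU _ _ Uq _ => e /= he.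
move: Hq he; rewrite /= ler_norml !ltr_norml => /andP[? ?] /andP[? ?]; apply/andP; split; lra.
Qed.

Lemma realize_ultralimit : exists c : J -> M,
  forall (W : finType) (phi : (W -> M) -> R) (h : W -> J), isFormula phi ->
  forall eps, 0 < eps -> U (fun e => `|phi (e \o h) - phi (c \o h)| < eps).
Proof.
have [Mst _] := MM; have [[x0] _] := Mst.
have /choice[nxt Hn] : forall kp : nat * (J -> M), exists p', realizes kp.1 kp.2 ->
    realizes kp.1.+1 p' /\ forall j, (code j < kp.1)%N -> p' j = kp.2 j.
  move=> [k p] /=; case: (pselect (realizes k p)) => [h|no]; last by exists p.
  by have [p' h'] := realizes_step h; exists p'.
pose fix P k : J -> M := if k is k'.+1 then nxt (k', P k') else fun=> x0.
have PP k : realizes k (P k).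
  elim: k => [|k IH]; last exact: (Hn (k, P k) IH).1.
  move=> W phi h fphi hc eps e0; have PF : ProperFilter U by apply: ultra_proper.
  apply: ultraS UU _ _ (filterT) _ => e _.
  rewrite (_ : e \o h = P 0%N \o h) ?subrr ?normr0 //; apply/funext => w.
  by have := hc w; rewrite ltn0.
have Pst k j d : (code j < k)%N -> P (k + d)%N j = P k j.
  move=> lt; elim: d => [|d IH]; first by rewrite addn0.
  rewrite addnS /= (Hn (k + d, P (k + d))%N (PP _)).2 //=.
  exact: leq_trans lt (leq_addr _ _).
exists (fun j => P (code j).+1 j) => W phi h fphi eps e0.
pose k := \max_w (code (h w)).+1.
have hk w : (code (h w) < k)%N by apply: (leq_bigmax (F := fun w => (code (h w)).+1) w).
have := PP k W phi h fphi hk eps e0.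
rewrite (_ : P k \o h = (fun j => P (code j).+1 j) \o h) //.
apply/funext => w /=; have := hk w => lt.
by rewrite -(subnKC lt) Pst.
Qed.

End Realize.

Lemma increasing_enumeration (I : Type) (lt : I -> I -> Prop) (l : seq I) : strict_linear lt ->
  exists k (b : 'I_k -> I), (forall i j : 'I_k, lt (b i) (b j) <-> (i < j)%N) /\
    (forall x, List.In x l -> exists i, b i = x).
Proof.
case=> irr [tr tot].
pose T : eqType := {classic I}.
pose le (x y : T) : bool := `[< x = y \/ lt x y >].
pose s : seq T := sort le (undup (l : seq T)).
have us : uniq s by rewrite sort_uniq undup_uniq.
have trle : transitive le.
  move=> y x z /asboolP[->//|h] /asboolP[<-|h']; apply/asboolP; right=> //.
  exact: tr h h'.
have so : sorted le s.
  apply: sort_sorted => x y; apply/orP; case: (pselect (x = y)) => [->|ne].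
    by left; apply/asboolP; left.
  by case: (tot x y ne) => h; [left | right]; apply/asboolP; right.
have mem (x : T) : List.In (x : I) l -> x \in s.
  rewrite /s. rewrite mem_sort mem_undup; elim: l {s us so} => //= y l IH; rewrite in_cons.
  by case=> [->|/IH ->]; rewrite ?eqxx ?orbT.
exists (size s), (fun i => tnth (in_tuple s) i).
have lt1 (i j : 'I_(size s)) : (i < j)%N -> lt (tnth (in_tuple s) i) (tnth (in_tuple s) j).
  move=> ij; have x0 : T := tnth (in_tuple s) i.
  have := sorted_ltn_nth trle x0 so i j (ltn_ord i) (ltn_ord j) ij.
  rewrite -!(tnth_nth x0 (in_tuple s)) => /asboolP[E|//].
  have Eij := (tuple_uniqP (in_tuple s) us) i j E; by rewrite Eij ltnn in ij.
split.
  move=> i j; split=> [h|]; last exact: lt1.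
  rewrite ltnNge; apply/negP; rewrite leq_eqVlt => /orP[/eqP/val_inj E|/lt1 h'].
    by rewrite E in h; exact: irr h.
  exact: irr (tr _ _ _ h h').
move=> x /(mem x) xs; have is_ : (index (x : T) s < size s)%N by rewrite index_mem.
by exists (Ordinal is_); rewrite (tnth_nth (x : T)) /= nth_index.
Qed.

(** Turns the values of formulas into finitely many colours. *)
Lemma quantize (d : R) : 0 < d -> exists (Q : nat) (q : R -> 'I_Q.+1),
  forall x y, 0 <= x <= 1 -> 0 <= y <= 1 -> q x = q y -> `|x - y| < d.
Proof.
move=> d0; pose Q := Num.trunc (d^-1).
exists Q.+1, (fun x => inord (Num.trunc (x * Q.+1%:R))) => x y.
have Q0 : 0 < Q.+1%:R :> R by rewrite ltr0n.
have H (z : R) : 0 <= z <= 1 -> (Num.trunc (z * Q.+1%:R) < Q.+2)%N /\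
    (Num.trunc (z * Q.+1%:R))%:R <= z * Q.+1%:R < (Num.trunc (z * Q.+1%:R)).+1%:R.
  move=> /andP[z0 z1]; have z2 : 0 <= z * Q.+1%:R by rewrite mulr_ge0 // ltW.
  have it := truncn_itv z2; split=> //; case/andP: it => it _.
  rewrite ltnS -(ler_nat R). apply: (le_trans it).
  by rewrite -[leRHS]mul1r ler_wpM2r // ltW.
move=> /H[hx /andP[x1 x2]] /H[hy /andP[y1 y2]] /(congr1 val).
rewrite /= !inordK // => E; rewrite E in x1 x2.
have dQ : 1 < d * Q.+1%:R.
  have iv0 : 0 <= d^-1 by rewrite invr_ge0 ltW.
  have /andP[_ h] := truncn_itv iv0.
  by rewrite -ltr_pdivrMl // mulr1.
set T := Num.trunc _ in x1 x2 y1 y2; rewrite -(@natr1 R T) in x2 y2.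
rewrite -(ltr_pM2r Q0); apply: lt_trans dQ.
rewrite -{1}(gtr0_norm Q0) -normrM mulrBl ltr_norml; apply/andP; split; lra.
Qed.

(** The variables of [y_j] read the vertex [j] of an edge, those of [x] the last vertex. *)
Definition slot n (o : option 'I_n) : 'I_n.+1 :=
  if o is Some j then lift ord_max j else ord_max.

Section IPIndiscernible.
Variables (M : cstruct) (n : nat) (V : finType) (part : V -> option 'I_n) (f : (V -> M) -> R).
Hypotheses (MM : monster M) (ff : isFormula f).
Variables (r s : R) (a0 : 'I_n -> nat -> V -> M).
Hypothesis IP : forall w : seq {ffun 'I_n -> nat}, exists b : V -> M,
  forall iota : {ffun 'I_n -> nat},
    (f (ip_assign part b a0 iota) <= r <-> iota \in w) /\
    (f (ip_assign part b a0 iota) >= s <-> iota \notin w).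

Definition combine (T : Type) (e : T -> V -> M) (g : 'I_n.+1 -> T) : V -> M :=
  fun v => e (g (slot (part v))) v.

Lemma ip_words N : exists A : {ffun 'I_N -> bool} -> V -> M,
  forall g : 'I_n.+1 -> {ffun 'I_N -> bool},
  ((exists t, forall i, g i t) -> f (combine A g) <= r) /\
  (~ (exists t, forall i, g i t) -> s <= f (combine A g)).
Proof.
pose X := {ffun 'I_N -> bool}.
(* A word used in the place of some [y_j] is the index [pickle] of the word in a row of [a0]. Used
   in the place of the first variable, it needs a [b] for the tuples of words having a common 1 with
   it, a finite set because there are finitely many words. *)
pose wx (x : X) : seq {ffun 'I_n -> nat} := [seq [ffun j => pickle (y j)] |
  y : {ffun 'I_n -> X} <- enum {: {ffun 'I_n -> X}} & `[< exists t, x t /\ forall j, y j t >]].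
have /choice[b Hb] := fun x => IP (wx x).
exists (fun x v => if part v is Some j then a0 j (pickle x) v else b x v) => g.
pose io : {ffun 'I_n -> nat} := [ffun j => pickle (g (lift ord_max j))].
have -> : combine (fun x v => if part v is Some j then a0 j (pickle x) v else b x v) g =
    ip_assign part (b (g ord_max)) a0 io.
  by apply/funext => v; rewrite /combine /ip_assign /slot; case: (part v) => [j|//]; rewrite ffunE.
have E : io \in wx (g ord_max) <-> exists t, forall i, g i t.
  split=> [/mapP[y]|[t ht]].
    rewrite mem_filter => /andP[/asboolP[t [ht1 ht2]] _] /ffunP Ey; exists t => i.
    case: (unliftP ord_max i) => [j ->|->//].
    have := Ey j; rewrite !ffunE => /(pcan_inj pickleK) ->; exact: ht2.
  apply/mapP; exists [ffun j => g (lift ord_max j)].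
    rewrite mem_filter mem_enum andbT; apply/asboolP; exists t; split=> // j.
    by rewrite ffunE.
  by apply/ffunP => j; rewrite !ffunE.
have [H1 H2] := Hb (g ord_max) io; split=> [/E/H1 //|no].
by apply/H2/negP => /E.
Qed.

Variables (I : Type) (H : og_on n I).
Hypotheses (HH : is_ohg H) (cI : countable_type I).

Definition coded (e : I * V -> M) (g : 'I_n.+1 -> I) :=
  (gR H g -> f (combine (fun i v => e (i, v)) g) <= r) /\
  (~ gR H g -> s <= f (combine (fun i v => e (i, v)) g)).

(** A finite fragment of the requirements: indiscernibility for one formula and one pair of tuples,
    up to [reps]; [meets] adds the coding of edges on [ru]. *)
Record request := Request {
  rm : nat; ru : 'I_rm -> I; rv : 'I_rm -> I;
  rqlt : qf_eq_lt (glt H) ru rv; rqR : qf_R (gR H) ru rv;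
  rW : finType; rphi : (rW -> M) -> R; rg : rW -> 'I_rm * V;
  rform : isFormula rphi; reps : R; reps_gt0 : 0 < reps }.

Definition meets (q : request) (e : I * V -> M) :=
  `|rphi (fun w => e (ru (rg (r:=q) w).1, (rg w).2)) -
    rphi (fun w => e (rv (rg (r:=q) w).1, (rg w).2))| < reps q /\
  forall t : 'I_n.+1 -> 'I_(rm q), injective (fun i => ru (t i)) -> coded e (fun i => ru (t i)).

Lemma requests_met l (q : 'I_l -> request) : exists e, forall i, meets (q i) e.
Proof.
have [Mst _] := MM; have bnd := isFormula_bounds Mst.
have [slin [Rsym Rinj]] := HH.
pose pts := flatten [seq [seq ru i | i : 'I_(rm (q j))] ++ [seq rv i | i : 'I_(rm (q j))] | j : 'I_l].
have [k [be [hbe cov]]] := increasing_enumeration pts slin.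
have In_map (T T' : Type) (h : T -> T') x (t : seq T) : List.In x t -> List.In (h x) [seq h z | z <- t].
  by elim: t => //= z t IH [->|/IH]; [left | right].
have In_cat (T : Type) (x : T) t1 t2 : List.In x (t1 ++ t2) <-> List.In x t1 \/ List.In x t2.
  elim: t1 => [|z t1 IH] /=; first by split=> [|[]//]; right.
  by rewrite IH; split=> [[|[]]|[[|]|]]; auto.
have In_flat (T : Type) (x : T) t (ts : seq (seq T)) : List.In t ts -> List.In x t -> List.In x (flatten ts).
  by elim: ts => //= z ts IH [-> h|h1 h2]; apply/In_cat; [left | right; exact: IH].
have In_enum (T : finType) (x : T) : List.In x (enum T).
  have : x \in enum T by rewrite mem_enum.
  by elim: (enum T) => //= z t IH; rewrite in_cons => /orP[/eqP->|/IH]; [left | right].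
have ex_u j (i : 'I_(rm (q j))) : exists i', be i' = ru i.
  apply: cov; apply: In_flat (In_map _ _ _ _ _ (In_enum _ j)) _.
  by apply/In_cat; left; apply: In_map.
pose u j (i : 'I_(rm (q j))) := projT1 (cid (ex_u j i)).
have Hu j i : be (u j i) = ru i by exact: projT2 (cid (ex_u j i)).
have ex_v j (i : 'I_(rm (q j))) : exists i', be i' = rv i.
  apply: cov; apply: In_flat (In_map _ _ _ _ _ (In_enum _ j)) _.
  by apply/In_cat; right; apply: In_map.
pose v j (i : 'I_(rm (q j))) := projT1 (cid (ex_v j i)).
have Hv j i : be (v j i) = rv i by exact: projT2 (cid (ex_v j i)).
have irr : forall x, ~ glt H x x by case: slin.
have be_inj : injective be.
  move=> i j E; case: (ltngtP i j) => [/hbe|/hbe|/val_inj//]; rewrite E; by move/irr.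
pose Rel (a : 'I_n.+1 -> 'I_k) := gR H (fun i => be (a i)).
have Relsym : symmetric_rel Rel by move=> a p; exact: Rsym.
have Relinj a : Rel a -> injective a by move/Rinj => h i j E; apply: h; rewrite E.
have [d [d0 hd]] := min_pos (fun i => reps_gt0 (q i)).
have [Q [qt hq]] := quantize d0.
have huv j : qf_eq_lt (fun x y : 'I_k => (x < y)%N) (u j) (v j) /\ qf_R Rel (u j) (v j).
  have [h1 h2] := rqlt (q j); split; [split=> i i'|move=> t].
  - split=> E; apply: be_inj; rewrite ?Hu ?Hv; apply/h1; by rewrite -?Hu -?Hv E.
  - by rewrite -!hbe !Hu !Hv.
  rewrite /Rel (_ : (fun i => be (u j (t i))) = (fun i => ru (t i))); last first.
    by apply/funext => i; rewrite Hu.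
  rewrite (_ : (fun i => be (v j (t i))) = (fun i => rv (t i))); last first.
    by apply/funext => i; rewrite Hv.
  exact: rqR.
have [N HN] := ordered_hypergraph_ramsey Relsym Relinj 'I_Q.+1 huv.
have [A HA] := ip_words N.
(* The colours are quantized values, and equal colours mean values closer than every [reps]. *)
have [x [Hx1 Hx2]] := HN (fun j y => qt (rphi (fun w => A (y (rg (r:=q j) w).1) (rg w).2))).
have [x' Hx'] : exists x', forall j, x' (be j) = x j.
  exists (fun i => if pselect (exists j, be j = i) is left h then x (projT1 (cid h))
                   else [ffun=> false]) => j.
  case: pselect => [h|[]]; last by exists j.
  by congr x; apply: be_inj; exact: (projT2 (cid h)).
exists (fun iv => A (x' iv.1) iv.2) => j; split=> /=.
  apply: lt_le_trans (hd j); apply: hq.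
  - exact: (bnd _ _ (@rform (q j))).
  - exact: (bnd _ _ (@rform (q j))).
  have := Hx2 j.
  rewrite (_ : (fun w => A (x (u j _)) _) = (fun w => A (x' (ru (rg (r:=q j) w).1)) (rg w).2)); last first.
    by apply/funext => w; rewrite -Hu Hx'.
  rewrite (_ : (fun w => A (x (v j _)) _) = (fun w => A (x' (rv (rg (r:=q j) w).1)) (rg w).2)) //.
  by apply/funext => w; rewrite -Hv Hx'.
move=> t tinj.
pose a i := u j (t i).
have Ea : (fun i => ru (t i)) = (fun i => be (a i)).
  by apply/funext => i; rewrite /a Hu.
have ainj : injective a by move=> i i' E; apply: tinj; rewrite -!Hu; congr be.
have [h1 h2] := HA (fun i => x (a i)).
have Ec : combine (fun i vv => A (x' i) vv) (fun i => ru (t i)) = combine A (fun i => x (a i)).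
  by apply/funext => vv; rewrite /combine -Hu Hx'.
split; rewrite /= Ec Ea => hR; first exact/h1/(Hx1 a ainj).
by apply: h2 => /(Hx1 a ainj).
Qed.

Theorem ip_indiscernible : exists a : I -> V -> M, og_indiscernible H a /\
  forall g : 'I_n.+1 -> I, injective g ->
    (gR H g -> f (combine a g) <= r) /\ (~ gR H g -> s <= f (combine a g)).
Proof.
have [Mst _] := MM.
pose F (X : set (I * V -> M)) := exists l (q : 'I_l -> request),
  forall e, (forall i, meets (q i) e) -> X e.
have FF : ProperFilter F.
  split; first by move=> [l [q h]]; have [e he] := requests_met q; exact: h he.
  split.
  - by exists 0%N, (fun i : 'I_0 => match notF (ltn_ord i) with end).
  - move=> X Y [l [q h]] [l' [q' h']]; exists (l + l')%N, (fun i => match split i with inl j => q j | inr j => q' j end).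
    move=> e he; split; [apply: h => i; have := he (lshift l' i) | apply: h' => i; have := he (rshift l i)].
      by rewrite (unsplitK (inl i)).
    by rewrite (unsplitK (inr i)).
  by move=> X Y XY [l [q h]]; exists l, q => e /h /XY.
have [U [UU FU]] := ultraFilterLemma FF.
have [cI1 cI1_inj] := cI.
pose code (j : I * V) : nat := pickle (cI1 j.1, j.2).
have code_inj : injective code.
  by move=> [i v] [i' v'] /(pcan_inj pickleK) [/cI1_inj -> ->].
have [c Hc] := realize_ultralimit MM code_inj UU.
have Umeets q : U (meets q).
  by apply: FU; exists 1%N, (fun=> q) => e /(_ ord0).
exists (fun i v => c (i, v)); split.
  move=> m u v hlt hR W g phi fphi.
  apply/eqP; rewrite -subr_eq0 -normr_eq0; apply/negPn/negP => ne.
  (* A third for each of the two passages to the limit, and a third for the request. *)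
  have e0 : 0 < `|phi (fun w => seq_tuple (fun i v => c (i, v)) u (g w)) -
                  phi (fun w => seq_tuple (fun i v => c (i, v)) v (g w))| / 3.
    by rewrite divr_gt0 // lt0r ne normr_ge0.
  set d := _ / 3 in e0.
  pose q := @Request m u v hlt hR W phi g fphi d e0.
  have U1 := Hc W phi (fun w => (u (g w).1, (g w).2)) fphi d e0.
  have U2 := Hc W phi (fun w => (v (g w).1, (g w).2)) fphi d e0.
  have [e [h1 [h2 [h3 _]]]] := ultra_ex UU (ultraI UU U1 (ultraI UU U2 (Umeets q))).
  have E : `|phi (fun w => seq_tuple (fun i v => c (i, v)) u (g w)) -
             phi (fun w => seq_tuple (fun i v => c (i, v)) v (g w))| = 3 * d.
    by rewrite /d mulrC divfK // pnatr_eq0.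
  move: E h1 h2 h3; rewrite /seq_tuple /comp /= => E h1 h2 h3.
  move: h1 h2 h3; rewrite !ltr_norml => /andP[? ?] /andP[? ?] /andP[? ?].
  have : `|phi (fun w => c (u (g w).1, (g w).2)) - phi (fun w => c (v (g w).1, (g w).2))| < 3 * d.
    by rewrite ltr_norml; apply/andP; split; lra.
  by rewrite E ltxx.
move=> g ginj.
have qlt : qf_eq_lt (glt H) g g by [].
have qR : qf_R (gR H) g g by [].
(* With equal tuples the indiscernibility clause is trivial, and what remains is the coding of the
   edges on [g]. *)
pose q := @Request n.+1 g g qlt qR V f (fun v => (ord0, v)) ff 1 ltr01.
have near eps : 0 < eps -> exists e : I * V -> M, coded e g /\
    `|f (combine (fun i v => e (i, v)) g) - f (combine (fun i v => c (i, v)) g)| < eps.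
  move=> e0; have U1 := Hc V f (fun v => (g (slot (part v)), v)) ff eps e0.
  have [e [h1 [_ h2]]] := ultra_ex UU (ultraI UU U1 (Umeets q)).
  by exists e; split=> //; apply: (h2 id).
split=> hR; rewrite leNgt; apply/negP => lt.
  have [|e [[h1 _] h2]] := near (f (combine (fun i v => c (i, v)) g) - r); first by rewrite subr_gt0.
  by have := h1 hR; move: h2; rewrite ltr_norml => /andP[? ?]; lra.
have [|e [[_ h1] h2]] := near (s - f (combine (fun i v => c (i, v)) g)); first by rewrite subr_gt0.
by have := h1 hR; move: h2; rewrite ltr_norml => /andP[? ?]; lra.
Qed.

End IPIndiscernible.

Local Close Scope classical_set_scope.

(** * Generic ordered hypergraphs *)

(* Ordered (n+1)-uniform hypergraphs whose vertices carry one of [t] tags, edges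
   being confined to tuples of tags in [Q]. One tag and no condition gives
   the structures of G_{n+1}; tags in ['I_n.+1] and [Q] injectivity gives those
   of G_{n+1,p}. *)
Record thg (t n : nat) (I : Type) := THG {
  tlt : I -> I -> Prop; tR : ('I_n.+1 -> I) -> Prop; ttag : I -> 'I_t }.

Section Tagged.
Variables (t n : nat) (Q : ('I_n.+1 -> 'I_t) -> Prop).

Definition is_thg (I : Type) (G : thg t n I) : Prop :=
  strict_linear (tlt G) /\ symmetric_rel (tR G) /\
  (forall a, tR G a -> injective a /\ Q (fun k => ttag G (a k))) /\
  (forall x y, (ttag G x < ttag G y)%N -> tlt G x y).

Definition thg_emb (A B : Type) (F : thg t n A) (G : thg t n B) (f : A -> B) : Prop :=
  injective f /\ (forall x y, tlt F x y <-> tlt G (f x) (f y)) /\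
  (forall a, tR F a <-> tR G (fun k => f (a k))) /\ (forall x, ttag F x = ttag G (f x)).

(** A finite partial isomorphism given by its graph; [List.In] asks for no decidable equality on the
    vertices. *)
Definition piso (A B : Type) (F : thg t n A) (G : thg t n B) (p : seq (A * B)) : Prop :=
  (forall z z', List.In z p -> List.In z' p ->
     (z.1 = z'.1 <-> z.2 = z'.2) /\ (tlt F z.1 z'.1 <-> tlt G z.2 z'.2)) /\
  (forall z, List.In z p -> ttag F z.1 = ttag G z.2) /\
  (forall c : 'I_n.+1 -> A * B, (forall k, List.In (c k) p) ->
     (tR F (fun k => (c k).1) <-> tR G (fun k => (c k).2))).

(* The one-point extension property characterizing the Fraisse limit. *)
Definition ext_prop (B : Type) (G : thg t n B) : Prop :=
  forall (A : Type) (F : thg t n A), is_thg F -> forall p, piso F G p ->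
  forall x, exists y, piso F G ((x, y) :: p).

Lemma piso_sub (A B : Type) (F : thg t n A) (G : thg t n B) p p' :
  (forall z, List.In z p' -> List.In z p) -> piso F G p -> piso F G p'.
Proof.
by move=> s [h1 [h2 h3]]; split; [|split]; auto => c hc; apply: h3 => k; apply: s.
Qed.

(** The bookkeeping common to embedding and back-and-forth: [Gl k] is the task of step [k], and
    finitely many pairs of the union lie in one stage. *)
Lemma chain_limit (A B : Type) (P : seq (A * B) -> Prop) (Gl : nat -> seq (A * B) -> Prop) p0 :
  P p0 -> (forall k p, P p -> exists p', P p' /\ (forall z, List.In z p -> List.In z p') /\ Gl k p') ->
  exists Z : A * B -> Prop, (forall z, List.In z p0 -> Z z) /\
    (forall k, exists p, Gl k p /\ forall z, List.In z p -> Z z) /\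
    (forall m (c : 'I_m -> A * B), (forall i, Z (c i)) -> exists p, P p /\ forall i, List.In (c i) p).
Proof.
move=> P0 step.
have /choice[nxt Hn] : forall kp : nat * seq (A * B), exists p', P kp.2 ->
    P p' /\ (forall z, List.In z kp.2 -> List.In z p') /\ Gl kp.1 p'.
  move=> [k p] /=; case: (pselect (P p)) => [h|no]; last by exists p.
  by have [p' h'] := step k p h; exists p'.
pose fix S k := if k is k'.+1 then nxt (k', S k') else p0.
have PS k : P (S k) by elim: k => [//|k IH]; exact: (Hn (k, S k) IH).1.
have mon k d z : List.In z (S k) -> List.In z (S (k + d)%N).
  elim: d => [|d IH]; first by rewrite addn0.
  by move/IH; rewrite addnS; exact: (Hn (_, _) (PS (k + d)%N)).2.1.
exists (fun z => exists k, List.In z (S k)); split; first by exists 0%N.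
split.
  move=> k; exists (S k.+1); split; first exact: (Hn (k, S k) (PS k)).2.2.
  by move=> z; exists k.+1.
move=> m c /choice[f Hf]; exists (S (\max_i f i)); split=> // i.
by rewrite -(subnKC (leq_bigmax i)); exact: mon.
Qed.

Lemma ext_prop_embeds (A B : Type) (F : thg t n A) (G : thg t n B) :
  ext_prop G -> countable_type A -> is_thg F -> exists f, thg_emb F G f.
Proof.
move=> EG [code inj] HF.
have P0 : piso F G [::].
  by split=> //; split=> // c h; case: (h ord0).
have [|Z [_ [Zall Zfin]]] := chain_limit (Gl := fun k p => forall x, code x = k -> exists y, List.In (x, y) p) P0.
  move=> k p Pp; case: (pselect (exists x, code x = k)) => [[x xk]|no]; last first.
    by exists p; split=> //; split=> // x xk; case: no; exists x.
  have [y Py] := EG _ _ HF _ Pp x; exists ((x, y) :: p); split=> //; split; first by right.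
  by move=> x' x'k; exists y; left; rewrite (inj x x') // xk x'k.
have /choice[f Hf] : forall x, exists y, Z (x, y).
  by move=> x; have [p [hp hZ]] := Zall (code x); have [y /hZ] := hp x erefl; exists y.
exists f.
have two x y : (x = y <-> f x = f y) /\ (tlt F x y <-> tlt G (f x) (f y)) /\ ttag F x = ttag G (f x).
  have [|p [[h1 [h2 _]] hp]] := Zfin 2%N (fun i => if i == ord0 then (x, f x) else (y, f y)).
    by move=> i; case: ifP.
  have hx := hp ord0; have hy := hp ord_max; rewrite /= in hx hy.
  by have [? ?] := h1 _ _ hx hy; have := h2 _ hx.
split; first by move=> x y /(two x y).1.
split; first by move=> x y; exact: (two x y).2.1.
split=> [a|x]; last exact: (two x x).2.2.
have [|p [[_ [_ h]] hp]] := Zfin _ (fun i => (a i, f (a i))); first by move=> i.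
exact: (h _ hp).
Qed.

Lemma piso_swap (A B : Type) (F : thg t n A) (G : thg t n B) p :
  piso F G p -> piso G F [seq (z.2, z.1) | z <- p].
Proof.
have In_map z : List.In z [seq (z.2, z.1) | z <- p] -> List.In (z.2, z.1) p.
  by elim: p => //= y p IH [<-|/IH h]; [left; case: y | right].
move=> [h1 [h2 h3]]; split; [|split].
- by move=> z z' /In_map h /In_map h'; have [e1 e2] := h1 _ _ h h'; rewrite e1 e2.
- by move=> z /In_map /h2.
by move=> c hc; have := h3 _ (fun k => In_map _ (hc k)) => /= ->.
Qed.

Lemma In_map_swap (A B : Type) (p : seq (A * B)) x y :
  List.In (x, y) p -> List.In (y, x) [seq (z.2, z.1) | z <- p].
Proof. by elim: p => //= z p IH [->|/IH]; [left | right]. Qed.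

Lemma In_codom (T : Type) m (c : 'I_m -> T) z :
  List.In z [seq c i | i <- enum 'I_m] <-> exists i, c i = z.
Proof.
split.
  by elim: (enum 'I_m) => //= i s IH [<-|]; [exists i | exact: IH].
case=> i <-; have : i \in enum 'I_m by rewrite mem_enum.
by elim: (enum 'I_m) => //= j s IH; rewrite in_cons => /orP[/eqP->|/IH]; [left | right].
Qed.

Definition homog (B : Type) (G : thg t n B) := forall (m : nat) (u v : 'I_m -> B),
  injective u -> injective v ->
  (forall i j, tlt G (u i) (u j) <-> tlt G (v i) (v j)) -> qf_R (tR G) u v ->
  (forall i, ttag G (u i) = ttag G (v i)) ->
  exists s : B -> B, bijective s /\ thg_emb G G s /\ forall i, s (u i) = v i.

Lemma ext_prop_homog (B : Type) (G : thg t n B) :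
  ext_prop G -> countable_type B -> is_thg G -> homog G.
Proof.
move=> EG [code inj] HG m u v iu iv hlt hR htag.
pose p0 := [seq (u i, v i) | i <- enum 'I_m].
have P0 : piso G G p0.
  split; [|split].
  - move=> z z' /In_codom[i <-] /In_codom[j <-] /=; split; last exact: hlt.
    by split=> [/iu->|/iv->].
  - by move=> z /In_codom[i <-]; exact: htag.
  move=> c hc; have /choice[s Hs] : forall k, exists i, (u i, v i) = c k.
    by move=> k; apply/In_codom.
  by rewrite (_ : c = (fun k => (u (s k), v (s k)))); [exact: hR | apply/funext].
have [|Z [Z0 [Zall Zfin]]] := chain_limit (Gl := fun k p =>
    (forall x, code x = k -> exists y, List.In (x, y) p) /\
    (forall y, code y = k -> exists x, List.In (x, y) p)) P0.
  move=> k p Pp; case: (pselect (exists x, code x = k)) => [[x xk]|no]; last first.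
    by exists p; split=> //; split=> //; split=> x xk; case: no; exists x.
  (* The point of code [k] is treated twice, as an argument and, after a swap, as a value. *)
  have [y Py] := EG _ _ HG _ Pp x.
  have [y' Py'] := EG _ _ HG _ (piso_swap Py) x.
  exists [seq (z.2, z.1) | z <- (x, y') :: [seq (z.2, z.1) | z <- (x, y) :: p]].
  split; first exact: piso_swap.
  have sub z : List.In z ((x, y) :: p) -> List.In z
     [seq (z.2, z.1) | z <- (x, y') :: [seq (z.2, z.1) | z <- (x, y) :: p]].
    by move=> h; right; case: z h => z1 z2 h; apply/In_map_swap/In_map_swap.
  split; first by move=> z h; apply: sub; right.
  split=> x' x'k; rewrite -(inj x x' (etrans xk (esym x'k))).
    by exists y; apply: sub; left.
  by exists y'; left.
have /choice[f Hf] : forall x, exists y, Z (x, y).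
  by move=> x; have [p [[hp _] hZ]] := Zall (code x); have [y /hZ] := hp x erefl; exists y.
have /choice[g Hg] : forall y, exists x, Z (x, y).
  by move=> y; have [p [[_ hp] hZ]] := Zall (code y); have [x /hZ] := hp y erefl; exists x.
have two x y x' y' : Z (x, y) -> Z (x', y') ->
    (x = x' <-> y = y') /\ (tlt G x x' <-> tlt G y y') /\ ttag G x = ttag G y.
  move=> h h'; have [|p [[h1 [h2 _]] hp]] := Zfin 2%N (fun i => if i == ord0 then (x, y) else (x', y')).
    by move=> i; case: ifP.
  have hx := hp ord0; have hy := hp ord_max; rewrite /= in hx hy.
  by have [? ?] := h1 _ _ hx hy; have := h2 _ hx.
exists f; split; [|split].
- exists g => x; first by apply/(two _ _ _ _ (Hg (f x)) (Hf x)).1.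
  by apply/(two _ _ _ _ (Hf (g x)) (Hg x)).1.
- split; first by move=> x x' /(two _ _ _ _ (Hf x) (Hf x')).1.
  split; first by move=> x x'; exact: (two _ _ _ _ (Hf x) (Hf x')).2.1.
  split=> [a|x]; last exact: (two _ _ _ _ (Hf x) (Hf x)).2.2.
  have [|p [[_ [_ h]] hp]] := Zfin _ (fun i => (a i, f (a i))); first by move=> i.
  exact: (h _ hp).
move=> i; have Zi : Z (u i, v i) by apply: Z0; apply/In_codom; exists i.
by apply/(two _ _ _ _ (Hf (u i)) Zi).1.
Qed.

Lemma injective_enumeration (T : Type) (p : seq T) :
  exists m (c : 'I_m -> T), injective c /\ forall z, List.In z p <-> exists i, c i = z.
Proof.
elim: p => [|x p [m [c [ic hc]]]].
  exists 0%N, (fun i : 'I_0 => match notF (ltn_ord i) with end).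
  by split=> [[]//|z]; split=> // -[[]].
case: (pselect (List.In x p)) => [xp|nx].
  exists m, c; split=> // z /=; rewrite -hc; split; last by right.
  by case=> [<-|].
exists m.+1, (fun i => if unlift ord_max i is Some j then c j else x); split.
  move=> i j; case: (unliftP ord_max i) => [i' ->|->]; case: (unliftP ord_max j) => [j' ->|->] //.
  - by move/ic=> ->.
  - by move=> E; case: nx; apply/hc; exists i'.
  by move=> E; case: nx; apply/hc; exists j'.
move=> z /=; split.
  case=> [<-|/hc[i <-]]; first by exists ord_max; rewrite unlift_none.
  by exists (lift ord_max i); rewrite liftK.
case=> i; case: (unliftP ord_max i) => [i' _|_]; last by left.
by move=> <-; right; apply/hc; exists i'.
Qed.

Definition univ (B : Type) (G : thg t n B) := forall (m : nat) (F : thg t n 'I_m),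
  is_thg F -> exists f, thg_emb F G f.

Lemma is_thg_pullback (A B : Type) (F : thg t n A) (f : B -> A) : injective f -> is_thg F ->
  is_thg (THG (fun x y => tlt F (f x) (f y)) (fun a => tR F (fun k => f (a k))) (fun x => ttag F (f x))).
Proof.
move=> inj [[h1 [h2 h3]] [h4 [h5 h6]]]; split; [|split; [|split]] => /=.
- by split; [|split] => [x|x y z|x y ne]; eauto; apply: h3 => /inj.
- by move=> a s; exact: (h4 (fun k => f (a k))).
- by move=> a /h5[h ?]; split=> // i j E; apply: h; rewrite E.
- by move=> x y /h6.
Qed.

(** Universality embeds the domain of [p] together with [x]; homogeneity then moves the image of the
    domain onto the range of [p]. *)
Lemma univ_homog_ext_prop (B : Type) (G : thg t n B) : univ G -> homog G -> ext_prop G.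
Proof.
move=> UG HoG A F HF p Pp x.
case: (pselect (exists y, List.In (x, y) p)) => [[y xy]|no].
  by exists y; apply: piso_sub Pp => z /= [<-|].
have [m [c [ic hc]]] := injective_enumeration p.
have [h1 [h2 h3]] := Pp.
have cp i : List.In (c i) p by apply/hc; exists i.
have iu : injective (fun i => (c i).1).
  move=> i j E; have := (h1 _ _ (cp i) (cp j)).1.1 E => E'.
  by apply: ic; rewrite [c i]surjective_pairing E E' -surjective_pairing.
have iv : injective (fun i => (c i).2).
  move=> i j E; have := (h1 _ _ (cp i) (cp j)).1.2 E => E'.
  by apply: ic; rewrite [c i]surjective_pairing E E' -surjective_pairing.
pose W (i : 'I_m.+1) := if unlift ord_max i is Some j then (c j).1 else x.
have Wl i : W (lift ord_max i) = (c i).1 by rewrite /W liftK.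
have Wm : W ord_max = x by rewrite /W unlift_none.
have iW : injective W.
  move=> i j; rewrite /W; case: (unliftP ord_max i) => [i' ->|->]; case: (unliftP ord_max j) => [j' ->|->] //.
  - by move/iu=> ->.
  - by move=> E; case: no; exists (c i').2; rewrite -E -surjective_pairing.
  by move=> E; case: no; exists (c j').2; rewrite E -surjective_pairing.
have [g [ig [g1 [g2 g3]]]] := UG _ _ (is_thg_pullback iW HF).
have [|||||s [bs [[is_ [s1 [s2 s3]]] hs]]] :=
  HoG m (fun i => g (lift ord_max i)) (fun i => (c i).2).
- by move=> i j /ig /lift_inj.
- by [].
- move=> i j; rewrite -g1 /= !Wl; exact: (h1 _ _ (cp i) (cp j)).2.
- move=> k; rewrite -(g2 (fun i => lift ord_max (k i))) /=.
  rewrite (_ : (fun i => W _) = (fun i => (c (k i)).1)); first exact: h3.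
  by apply/funext => i; rewrite Wl.
- by move=> i; rewrite -g3 /= Wl; exact: h2.
exists (s (g ord_max)).
have rep z : List.In z ((x, s (g ord_max)) :: p) -> exists i, z = (W i, s (g i)).
  case=> [<-|/hc[i <-]]; first by exists ord_max; rewrite Wm.
  by exists (lift ord_max i); rewrite Wl hs -surjective_pairing.
split; [|split].
- move=> _ _ /rep[i ->] /rep[j ->] /=; split; last by rewrite -s1 -g1.
  by split=> [/iW->|/is_/ig->].
- by move=> _ /rep[i ->] /=; rewrite -s3 -g3.
move=> d hd; have /choice[k Hk] := fun i => rep _ (hd i).
rewrite (_ : d = (fun i => (W (k i), s (g (k i))))); last exact/funext.
by rewrite -(s2 (fun i => g (k i))) -(g2 k).
Qed.

End Tagged.

(* Since sqrt 2 is irrational, the sets [weight (_, j)], for [j : nat], are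
   pairwise disjoint dense subsets of the line. *)
Definition weight (z : rat * nat) : R := ratr z.1 + z.2%:R * Num.sqrt 2.

Lemma weight_inj : injective weight.
Proof.
move=> [a j] [b k] /= E.
have E1 : ratr (a - b) = (k%:R - j%:R) * Num.sqrt 2 :> R.
  rewrite rmorphB /= mulrBl; move: E; rewrite /weight /=.
  by move: (_ * Num.sqrt 2) (_ * Num.sqrt 2) => u v; lra.
have E2 : (a - b) ^+ 2 = (k%:R - j%:R) ^+ 2 * 2.
  apply: (fmorph_inj (ratr : {rmorphism rat -> R})).
  rewrite rmorphXn /= E1 exprMn sqr_sqrtr //.
  by rewrite rmorphM rmorphXn rmorphB /= !rmorph_nat.
suff kj : j = k.
  move: E2; rewrite kj subrr expr0n mul0r => /eqP; rewrite expf_eq0 /= subr_eq0 => /eqP ->//.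
apply/eqP/negPn/negP => ne.
pose d : int := k%:Z - j%:Z.
have d0 : `|d|%N != 0%N by rewrite absz_eq0 subr_eq0 eqz_nat eq_sym.
have Ed : k%:R - j%:R = d%:~R :> rat by rewrite /d intrB.
pose c := a - b.
have E3 : (numq c ^+ 2 = d ^+ 2 * 2 * denq c ^+ 2)%R.
  apply/eqP; rewrite -(eqr_int rat) !expr2 !intrM -!expr2 -Ed -E2 -/c.
  by rewrite -exprMn -{2}(divq_num_den c) divfK // intr_eq0 denq_neq0.
have E4 : (`|numq c| ^ 2 = `|d| ^ 2 * 2 * `|denq c| ^ 2)%N.
  by have := congr1 absz E3; rewrite !expr2 !abszM -!mulnn.
have n0 : (0 < `|denq c|)%N by rewrite absz_gt0 denq_neq0.
have := congr1 (logn 2) E4.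
have d1 : (0 < `|d|)%N by rewrite lt0n.
have n1 : (0 < `|numq c|)%N.
  have : (0 < `|numq c| ^ 2)%N by rewrite E4 !muln_gt0 n0 d1.
  by rewrite expn_gt0 orbF.
rewrite -!mulnn !lognM ?muln_gt0 ?n0 ?n1 ?d1 //.
by move/(congr1 odd); rewrite !oddD !addbb.
Qed.

Lemma weight_dense j (x y : R) : x < y -> exists a : rat, x < weight (a, j) < y.
Proof.
move=> xy; have [|a] := @rat_in_itvoo R (x - j%:R * Num.sqrt 2) (y - j%:R * Num.sqrt 2).
  by rewrite ltrD2r.
rewrite in_itv /= => /andP[h1 h2]; exists a; rewrite /weight /=.
by rewrite -ltrBlDr h1 -ltrBrDr h2.
Qed.

(** Either side may be empty; the bound [B] then replaces it. *)
Lemma real_gap m (lo hi : pred 'I_m) (v : 'I_m -> R) :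
  (forall i j, lo i -> hi j -> v i < v j) ->
  exists a b, a < b /\ forall i, (lo i -> v i <= a) /\ (hi i -> b <= v i).
Proof.
move=> h; pose B := \big[Num.max/0]_i `|v i| + 1.
have Bv i : `|v i| < B.
  by apply: (@le_lt_trans _ _ (\big[Num.max/0]_i `|v i|)); [exact: le_bigmax | rewrite ltrDl].
have B0 : 0 < B by apply: lt_le_trans ltr01 _; rewrite lerDr bigmax_ge_id.
exists (\big[Num.max/- B]_(i | lo i) v i), (\big[Num.min/B]_(i | hi i) v i); split.
  apply/bigmax_ltP; split=> [|i li].
    apply: lt_bigmin => [|j _]; first lra.
    by have := Bv j; rewrite ltr_norml => /andP[].
  apply: lt_bigmin => [|j hj]; last exact: h.
  by have := Bv i; rewrite ltr_norml => /andP[].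
move=> i; split=> [li|hi_i]; first by apply: le_bigmax_cond.
exact: bigmin_le_cond.
Qed.

Lemma In_tnth (T : Type) (p : seq T) z : List.In z p <-> exists i, tnth (in_tuple p) i = z.
Proof.
elim: p => [|x p IH] /=; first by split=> // -[[]].
split=> [[<-|/IH[i <-]]|[i]].
- by exists ord0.
- by exists (lift ord0 i); rewrite !(tnth_nth x).
case: (unliftP ord0 i) => [i' ->|->]; last by left.
by move=> E; right; apply/IH; exists i'; rewrite -E !(tnth_nth x).
Qed.

(** * Explicit construction of the generic structure *)

Section Generic.
Variables (t n : nat) (Q : ('I_n.+1 -> 'I_t) -> Prop).
Hypothesis Qsym : forall tau (s : {perm 'I_n.+1}), Q tau -> Q (fun k => tau (s k)).

Definition gvert : Type := ('I_t * (rat * nat))%type.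

(* The natural number carried by a vertex encodes its rank together with the
   list of sets of vertices of smaller rank with which it forms an edge. *)
Definition gdata (x : gvert) : nat * seq (seq gvert) := odflt (0%N, [::]) (unpickle x.2.2).

Definition gen_thg : thg t n gvert := THG
  (fun x y : gvert => (x.1 < y.1)%N \/ x.1 = y.1 /\ weight x.2 < weight y.2)
  (fun a : 'I_n.+1 -> gvert => injective a /\ Q (fun k => (a k).1) /\ exists k,
     (forall l, l <> k -> ((gdata (a l)).1 < (gdata (a k)).1)%N) /\
     exists s, s \in (gdata (a k)).2 /\ forall z, z \in s <-> exists l, l <> k /\ a l = z)
  (fun x : gvert => x.1).

Lemma gen_is_thg : is_thg Q gen_thg.
Proof.
split; [|split; [|split]] => /=; last by left.
- split; [|split].
  + by move=> x [|[_]]; rewrite ?ltnn ?ltxx.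
  + move=> x y z [h|[E h]] [h'|[E' h']].
    * by left; exact: ltn_trans h h'.
    * by left; rewrite -E'.
    * by left; rewrite E.
    by right; split; [rewrite E | exact: lt_trans h h'].
  move=> x y ne; case: (ltngtP x.1 y.1) => [h|h|/val_inj E].
  + by left; left.
  + by right; left.
  case: (ltgtP (weight x.2) (weight y.2)) => [h|h|/weight_inj E'].
  + by left; right.
  + by right; right.
  by case: ne; rewrite [x]surjective_pairing E E' -surjective_pairing.
- move=> a s [inj [q [k [hk [S [hS hz]]]]]]; split; [|split].
  + by move=> i j /inj /perm_inj.
  + exact: (Qsym s q).
  exists (s^-1%g k); rewrite permKV; split.
    by move=> l ne; apply: hk => E; apply: ne; rewrite -E permK.
  exists S; split=> // z; rewrite hz; split=> -[l [ne <-]].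
    by exists (s^-1%g l); rewrite permKV; split=> // /perm_inj.
  by exists (s l); split=> // E; apply: ne; rewrite -E permK.
by move=> a [? [? _]].
Qed.

Lemma gvert_countable : countable_type gvert.
Proof. by exists pickle; exact: (pcan_inj pickleK). Qed.

(** The code [j] of the rank and edges of the new vertex is chosen first; the weights with second
    component [j] being dense, a position remains available in the required gap. *)
Lemma gen_ext_prop : ext_prop Q gen_thg.
Proof.
move=> A F HF p Pp x; have [slin [Fsym [Finj Ftag]]] := HF.
have [irr [tr tot]] := slin.
case: (pselect (exists y, List.In (x, y) p)) => [[y xy]|no].
  by exists y; apply: piso_sub Pp => z /= [<-|].
have [h1 [h2 h3]] := Pp.
pose pt := tnth (in_tuple p).
have ptP i : List.In (pt i) p by apply/In_tnth; exists i.
have nx i : (pt i).1 <> x by move=> E; case: no; exists (pt i).2; rewrite -E -surjective_pairing.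
pose test (g : {ffun 'I_n -> 'I_(size p)}) (l : 'I_n.+1) :=
  if unlift ord_max l is Some i then (pt (g i)).1 else x.
pose Dl := [seq [seq (pt (g i)).2 | i <- enum 'I_n] |
  g : {ffun 'I_n -> 'I_(size p)} <- enum {: {ffun 'I_n -> 'I_(size p)}} & `[< tR F (test g) >]].
(* Ranking above all points of [p] makes [y] the top vertex of every edge it forms with them, so
   that its own list decides these edges. *)
pose rk := (\max_i (gdata (pt i).2).1).+1.
pose j := pickle (rk, Dl).
pose same i := ttag F (pt i).1 == ttag F x.
have tagE i : ttag F (pt i).1 = (pt i).2.1 := h2 _ (ptP i).
have [|a [b [ab gap]]] := @real_gap (size p) (fun i => same i && `[< tlt F (pt i).1 x >])
   (fun i => same i && `[< tlt F x (pt i).1 >]) (fun i => weight (pt i).2.2).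
  move=> i i' /andP[/eqP si /asboolP li] /andP[/eqP si' /asboolP hi'].
  have := (h1 _ _ (ptP i) (ptP i')).2.1 (tr _ _ _ li hi') => /= -[|[_ //]].
  by rewrite -!tagE si si' ltnn.
have [q /andP[q1 q2]] := weight_dense j ab.
pose y : gvert := (ttag F x, (q, j)).
have ydata : gdata y = (rk, Dl) by rewrite /gdata /= pickleK.
have rky i : ((gdata (pt i).2).1 < (gdata y).1)%N.
  by rewrite ydata ltnS; exact: (leq_bigmax (F := fun i => (gdata (pt i).2).1)).
have ny i : (pt i).2 <> y by move=> E; have := rky i; rewrite E ltnn.
have cmp i : (tlt F (pt i).1 x <-> tlt gen_thg (pt i).2 y) /\
             (tlt F x (pt i).1 <-> tlt gen_thg y (pt i).2).
  rewrite /= -tagE; have [g1 g2] := gap i.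
  have asym u v : tlt F u v -> ~ tlt F v u by move=> h h'; exact: irr (tr _ _ _ h h').
  case: (ltngtP (ttag F (pt i).1) (ttag F x)) => [h|h|/val_inj E].
  - split; split=> [h'|h'].
    + by left.
    + exact: Ftag.
    + by case: (asym _ _ h'); exact: Ftag.
    by case: h' => [//|[E _]]; move: h; rewrite E ltnn.
  - split; split=> [h'|h'].
    + by case: (asym _ _ h'); exact: Ftag.
    + by case: h' => [//|[E _]]; move: h; rewrite E ltnn.
    + by left.
    exact: Ftag.
  rewrite /same E eqxx /= in g1 g2.
  case: (tot _ _ (nx i)) => h.
    have lt : weight (pt i).2.2 < weight (q, j) by apply: le_lt_trans q1; apply/g1/asboolP.
    split; split; auto; first by move=> /asym.
    by case=> [//|[_ h']]; have := lt_trans lt h'; rewrite ltxx.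
  have lt : weight (q, j) < weight (pt i).2.2 by apply: lt_le_trans q2 _; apply/g2/asboolP.
  split; split; auto; first by move=> /asym.
  by case=> [//|[_ h']]; have := lt_trans lt h'; rewrite ltxx.
have cases z : List.In z ((x, y) :: p) -> z = (x, y) \/ exists i, z = pt i.
  by case=> [->|/In_tnth[i <-]]; [left | right; exists i].
exists y.
have eq12 z z' : List.In z ((x, y) :: p) -> List.In z' ((x, y) :: p) -> (z.1 = z'.1 <-> z.2 = z'.2).
  move=> /cases[->|[i ->]] /cases[->|[i' ->]] //=.
  - by split=> E; [case: (nx i') | case: (ny i')].
  - by split=> E; [case: (nx i) | case: (ny i)].
  exact: (h1 _ _ (ptP i) (ptP i')).1.
have tag12 z : List.In z ((x, y) :: p) -> ttag F z.1 = ttag gen_thg z.2.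
  by case/cases=> [->//|[i ->]]; exact: tagE.
split; [|split] => //.
  move=> z z' hz hz'; split; first exact: eq12.
  case/cases: hz => [->|[i ->]]; case/cases: hz' => [->|[i' ->]].
  - split=> [/irr//|[|[_]]]; rewrite ?ltnn ?ltxx //.
  - exact: (cmp i').2.
  - exact: (cmp i).1.
  exact: (h1 _ _ (ptP i) (ptP i')).2.
move=> c hc.
have injE : injective (fun k => (c k).1) <-> injective (fun k => (c k).2).
  by split=> inj k k' E; apply: inj; apply/(eq12 _ _ (hc k) (hc k')).
case: (pselect (injective (fun k => (c k).1))) => [inj1|ninj]; last first.
  by split=> [/Finj[]//|[/injE]].
have inj2 := injE.1 inj1.
case: (pselect (exists k, c k = (x, y))) => [[k0 ck0]|nok]; last first.
  apply: h3 => k; case: (hc k) => // E; by case: nok; exists k.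
have /choice[g Hg] : forall i : 'I_n, exists i', c (lift k0 i) = pt i'.
  move=> i; case/cases: (hc (lift k0 i)) => [E|//].
  have := inj1 (lift k0 i) k0; rewrite E ck0 => /(_ erefl) E'.
  by have := neq_lift k0 i; rewrite E' eqxx.
pose G : {ffun 'I_n -> 'I_(size p)} := [ffun i => g i].
split=> [Rc|[_ [_ [k [hk [S [hS hz]]]]]]].
  split=> //; split.
    have [_] := Finj _ Rc.
    rewrite (_ : (fun k => ttag F _) = (fun k => (c k).2.1)) //.
    by apply/funext => k; exact: tag12.
  exists k0; split.
    move=> l ne; rewrite ck0; case: (unliftP k0 l) => [i El|//].
    by rewrite El Hg; exact: rky.
  exists [seq (pt (G i)).2 | i <- enum 'I_n]; split.
    rewrite ck0 ydata; apply/mapP; exists G => //.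
    rewrite mem_filter mem_enum andbT; apply/asboolP.
    pose sg (l : 'I_n.+1) := if unlift ord_max l is Some i then lift k0 i else k0.
    have Et : test G = (fun l => (c (sg l)).1).
      apply/funext => l; rewrite /test /sg; case: (unlift ord_max l) => [i|]; last by rewrite ck0.
      by rewrite ffunE Hg.
    have isg : injective sg.
      move=> l l'; rewrite /sg; case: (unliftP ord_max l) => [i ->|->];
        case: (unliftP ord_max l') => [i' ->|->] //.
      - by move/lift_inj=> ->.
      - by move=> E; have := neq_lift k0 i; rewrite E eqxx.
      by move=> E; have := neq_lift k0 i'; rewrite -E eqxx.
    apply: (symmetric_rel_range (b := fun k => (c k).1)) => //; rewrite Et.
      by move=> l l' /inj1 /isg.
    by move=> l; exists (sg l).
  move=> z; split=> [/mapP[i _ ->]|[l [ne <-]]].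
    exists (lift k0 i); rewrite Hg ffunE; split=> // E.
    by have := neq_lift k0 i; rewrite E eqxx.
  case: (unliftP k0 l) => [i ->|//]; apply/mapP; exists i; first by rewrite mem_enum.
  by rewrite Hg ffunE.
have Ek : k = k0.
  apply: contrapT => ne; have := hk k0 (fun E => ne (esym E)); rewrite ck0.
  case: (unliftP k0 k) => [i ->|//]; rewrite Hg => lt.
  by have := ltn_trans lt (rky (g i)); rewrite ltnn.
subst k; move: hS; rewrite ck0 ydata => /mapP[G']; rewrite mem_filter => /andP[/asboolP RG' _] ES.
apply: (symmetric_rel_range (b := test G')) => // l.
case: (unliftP k0 l) => [i Ei|->]; last first.
  by exists ord_max; rewrite /test unlift_none ck0.
have : (c l).2 \in S.
  apply/hz; exists l; split=> // E; have := neq_lift k0 i.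
  by rewrite -Ei E eqxx.
rewrite ES => /mapP[i' _ E]; exists (lift ord_max i'); rewrite /test liftK.
move: E; rewrite Ei Hg; exact: (h1 _ _ (ptP (g i)) (ptP (G' i'))).1.2.
Qed.

End Generic.

(** * IP from a sequence that is not order-indiscernible *)

(** Reduces a change of hypergraph to the addition of one edge. *)
Lemma finset_const (T : finType) (X : Type) (h : {set T} -> X) :
  (forall A x, h (x |: A) = h A) -> forall A B, h A = h B.
Proof.
move=> H; suff E A : h A = h set0 by move=> A B; rewrite !E.
have [k] := ubnP #|A|; elim: k A => // k IH A lt.
have [->//|[x xA]] := set_0Vmem A.
rewrite -(setD1K xA) H IH //.
by move: lt; rewrite (cardsD1 x) xA.
Qed.

Section NonIndiscernible.
Variables (M : cstruct) (n t : nat) (Q : ('I_n.+1 -> 'I_t) -> Prop).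
Hypothesis Qsym : forall tau (s : {perm 'I_n.+1}), Q tau -> Q (fun k => tau (s k)).
Variables (I : Type) (G : thg t n I) (K : Type) (a : I -> K -> M).
Hypotheses (HG : is_thg Q G) (EG : ext_prop Q G).
Hypothesis Ind : forall (m : nat) (u v : 'I_m -> I), qf_eq_lt (tlt G) u v -> qf_R (tR G) u v ->
  (forall i, ttag G (u i) = ttag G (v i)) -> same_type (seq_tuple a u) (seq_tuple a v).

Section Injective.
Variables (m : nat) (u v : 'I_m -> I).
Hypotheses (iu : injective u) (iv : injective v).
Hypotheses (huv : qf_eq_lt (tlt G) u v) (tuv : forall i, ttag G (u i) = ttag G (v i)).
Variables (V : finType) (g : V -> 'I_m * K) (phi : (V -> M) -> R).
Hypothesis fphi : isFormula phi.

Definition value (f : 'I_m -> I) : R := phi (fun w => a (f (g w).1) (g w).2).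

(** Varies the hypergraph over the fixed order and tags of [u]; the members of [E] that are not
    admissible edges are ignored. *)
Definition fin_thg (E : {set {set 'I_m}}) : thg t n 'I_m := THG
  (fun x y => tlt G (u x) (u y))
  (fun s => injective s /\ Q (fun k => ttag G (u (s k))) /\ s @: setT \in E)
  (fun x => ttag G (u x)).

Lemma imset_perm (s : 'I_n.+1 -> 'I_m) (p : {perm 'I_n.+1}) :
  [set s (p k) | k in setT] = s @: setT.
Proof.
apply/setP => x; apply/imsetP/imsetP => -[k _ ->]; first by exists (p k).
by exists (p^-1%g k); rewrite // permKV.
Qed.

Lemma fin_is_thg E : is_thg Q (fin_thg E).
Proof.
have [[irr [tr tot]] [_ [_ Gt]]] := HG; split; [|split; [|split]] => /=.
- by split; [|split] => [x|x y z|x y ne]; eauto; apply: tot => /iu.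
- move=> s p [inj [q h]]; split; first by move=> i j /inj /perm_inj.
  by split; [exact: (Qsym p q) | rewrite imset_perm].
- by move=> s [? [? _]].
- by move=> x y /Gt.
Qed.

Lemma value_emb E f f' : thg_emb (fin_thg E) G f -> thg_emb (fin_thg E) G f' -> value f = value f'.
Proof.
move=> [h1 [h2 [h3 h4]]] [h1' [h2' [h3' h4']]].
apply: (@Ind m f f' _ _ _ V g phi fphi).
- split=> [i j|i j]; last by rewrite -h2 -h2'.
  by split=> [/h1->|/h1'->].
- by move=> s; rewrite -(h3 s) -(h3' s).
by move=> i; rewrite -h4 -h4'.
Qed.

Lemma fin_emb_exists E : exists f, thg_emb (fin_thg E) G f.
Proof.
apply: (ext_prop_embeds EG); last exact: fin_is_thg.
by exists val; exact: val_inj.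
Qed.

Lemma fin_emb_self (f : 'I_m -> I) : injective f ->
  (forall x y, tlt G (u x) (u y) <-> tlt G (f x) (f y)) -> (forall i, ttag G (u i) = ttag G (f i)) ->
  exists E, thg_emb (fin_thg E) G f.
Proof.
move=> jf hlt htag; have [_ [Gsym [Ginj _]]] := HG.
exists [set X | `[< exists s, tR G (fun k => f (s k)) /\ X = s @: setT >]].
split=> //; split; first exact: hlt.
split=> [s|x]; last exact: htag.
split=> [[is_ [q]]|Rs] /=.
  rewrite inE => /asboolP[s' [Rs' E]].
  apply: (symmetric_rel_range (b := fun k => f (s' k))) => //; first by move=> i j /jf /is_.
  move=> i; have : s i \in s @: setT by apply: imset_f.
  by rewrite E => /imsetP[j _ ->]; exists j.
have [is_ q] := Ginj _ Rs; split; first by move=> i j E; apply: is_; rewrite E.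
split; first by rewrite (_ : (fun k => _) = (fun k => ttag G (f (s k)))) //; apply/funext => k; exact: htag.
by rewrite inE; apply/asboolP; exists s.
Qed.

Section Edge.
Variables (E : {set {set 'I_m}}) (s0 : 'I_n.+1 -> 'I_m).
Hypotheses (is0 : injective s0) (Qs0 : Q (fun k => ttag G (u (s0 k)))).
Let e := s0 @: setT.
Hypothesis eE : e \notin E.
Variable pos : bool.

(** Copies labelled by numbers serve the variables [y_j], copies labelled by finite sets [w] the
    variable [x]. *)
Definition label : Type := (nat + seq {ffun 'I_n -> nat})%type.

(* Blow-up of the structure on ['I_m]: every point gets copies, and the copies
   of the points of [e] form edges according to membership [iota \in w]. *)
Definition blowup : thg t n ('I_m * label) := THG
  (fun x y : 'I_m * label => tlt G (u x.1) (u y.1) \/ x.1 = y.1 /\ (pickle x.2 < pickle y.2)%N)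
  (fun c : 'I_n.+1 -> 'I_m * label =>
    injective (fun k => (c k).1) /\ Q (fun k => ttag G (u (c k).1)) /\
    (([set (c k).1 | k in setT] != e /\ [set (c k).1 | k in setT] \in E) \/
     ([set (c k).1 | k in setT] = e /\ exists (iota : {ffun 'I_n -> nat}) w,
       (iota \in w) == pos /\ (exists k, c k = (s0 ord_max, inr w)) /\
       forall j, exists k, c k = (s0 (lift ord_max j), inl (iota j)))))
  (fun x : 'I_m * label => ttag G (u x.1)).

Lemma blowup_is_thg : is_thg Q blowup.
Proof.
have [[irr [tr tot]] [_ [_ Gt]]] := HG; split; [|split; [|split]] => /=.
- split; [|split].
  + by move=> x [/irr//|[_]]; rewrite ltnn.
  + move=> x y z [h|[E1 h]] [h'|[E2 h']].
    * by left; exact: tr h h'.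
    * by left; rewrite -E2.
    * by left; rewrite E1.
    by right; split; [rewrite E1 | exact: ltn_trans h h'].
  move=> x y ne; case: (pselect (x.1 = y.1)) => [E1|ne1].
    case: (ltngtP (pickle x.2) (pickle y.2)) => [h|h|/(pcan_inj pickleK) E2].
    + by left; right.
    + by right; right.
    by case: ne; rewrite [x]surjective_pairing E1 E2 -surjective_pairing.
  by have [h|h] := tot (u x.1) (u y.1) (fun E' => ne1 (iu E')); [left; left | right; left].
- move=> c p [inj [q h]]; split; first by move=> i j /inj /perm_inj.
  split; first exact: (Qsym p q).
  rewrite (imset_perm (fun k => (c k).1)).
  case: h => [h|[h1 [iota [w [h2 [[k hk] hj]]]]]]; first by left.
  right; split=> //; exists iota, w; split=> //; split.
    by exists (p^-1%g k); rewrite permKV.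
  by move=> j; have [k' hk'] := hj j; exists (p^-1%g k'); rewrite permKV.
- move=> c [inj [q _]]; split=> // i j Eij; by apply: inj; rewrite Eij.
- by move=> x y h; left; exact: Gt.
Qed.

Definition choose_label (iota : {ffun 'I_n -> nat}) (w : seq {ffun 'I_n -> nat}) (i : 'I_m) : label :=
  if [pick j | s0 (lift ord_max j) == i] is Some j then inl (iota j)
  else if i == s0 ord_max then inr w else inl 0%N.

Lemma choose_label_lift iota w j : choose_label iota w (s0 (lift ord_max j)) = inl (iota j).
Proof.
rewrite /choose_label; case: pickP => [j' /eqP /is0 /lift_inj -> //|/(_ j)].
by rewrite eqxx.
Qed.

Lemma choose_label_max iota w : choose_label iota w (s0 ord_max) = inr w.
Proof.
rewrite /choose_label; case: pickP => [j' /eqP /is0 E'|_]; last by rewrite eqxx.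
by have := neq_lift ord_max j'; rewrite E' eqxx.
Qed.

(** Taking one copy of each point restores the original structure, except that the edge [e] is
    switched by [iota \in w]. *)
Lemma blowup_section h iota w : thg_emb blowup G h ->
  thg_emb (fin_thg (if (iota \in w) == pos then e |: E else E)) G (fun i => h (i, choose_label iota w i)).
Proof.
move=> [h1 [h2 [h3 h4]]]; split; first by move=> i j /h1[].
split.
  move=> x y; rewrite -h2 /=; split; first by left.
  by case=> // -[->]; rewrite ltnn.
split=> [s|x]; last by rewrite -h4.
rewrite -(h3 (fun k => (s k, choose_label iota w (s k)))) /=.
have P12 (A B C D : Prop) : (C <-> D) -> (A /\ B /\ C) <-> (A /\ B /\ D) by tauto.
apply: P12.
have [Ee|ne] := eqVneq (s @: setT) e; last first.
  have -> : (s @: setT \in (if (iota \in w) == pos then e |: E else E)) = (s @: setT \in E).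
    by case: ifP => // _; rewrite in_setU1 (negbTE ne).
  by split=> [hE|[[]//|[Eq _]]]; [left | move: ne; rewrite Eq eqxx].
have ek k : exists k', s k' = s0 k.
  have : s0 k \in e by apply: imset_f.
  by rewrite -Ee => /imsetP[k' _ ->]; exists k'.
split=> [hE|].
  right; split=> //; exists iota, w; split.
    by move: hE; case: ifP => // _; rewrite Ee (negbTE eE).
  split; first by have [k Ek] := ek ord_max; exists k; rewrite Ek choose_label_max.
  by move=> j; have [k Ek] := ek (lift ord_max j); exists k; rewrite Ek choose_label_lift.
case=> [[]//|[_]].
case=> [iota' [w' [hp [[k [Ek Ew]] hj]]]].
have <- : w' = w by move: Ew; rewrite Ek choose_label_max => -[].
have <- : iota' = iota.
  apply/ffunP => j; have [k' [Ek' Ej]] := hj j.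
  by move: Ej; rewrite Ek' choose_label_lift => -[].
by rewrite hp Ee setU11.
Qed.

(** [has_IP] asks for the smaller value exactly on [w], and [pos] tells whether this value is taken
    with or without the edge [e]. *)
Lemma edge_flip_ip (r s : R) : r < s ->
  (forall f, thg_emb (fin_thg (if pos then e |: E else E)) G f -> value f = r) ->
  (forall f, thg_emb (fin_thg (if pos then E else e |: E)) G f -> value f = s) ->
  has_IP (fun x : V => [pick j | s0 (lift ord_max j) == (g x).1]) phi.
Proof.
move=> rs hr hs.
have [|h hh] := ext_prop_embeds EG _ blowup_is_thg.
  by exists pickle; exact: (pcan_inj pickleK).
exists r, s; split=> //.
exists (fun j i x => a (h (s0 (lift ord_max j), inl i)) (g x).2) => w.
exists (fun x => a (h ((g x).1, if (g x).1 == s0 ord_max then inr w else inl 0%N)) (g x).2) => iota.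
set asg := ip_assign _ _ _ _.
have -> : phi asg = value (fun i => h (i, choose_label iota w i)).
  rewrite /value; congr phi; apply/funext => x; rewrite /asg /ip_assign /choose_label.
  by case: pickP => [j /eqP <-|//].
have hsec := blowup_section iota w hh.
have [iw|niw] := boolP (iota \in w).
  rewrite (hr _); first by split; split=> //; rewrite ?lexx // leNgt rs.
  by move: hsec; rewrite iw; case: (pos).
rewrite (hs _); first by split; split=> //; rewrite ?lexx // leNgt rs.
by move: hsec; rewrite (negbTE niw); case: (pos).
Qed.

End Edge.

Lemma injective_nonindiscernible_ip : value u <> value v -> exists part : V -> option 'I_n, has_IP part phi.
Proof.
move=> ne.
have [Eu hEu] := fin_emb_self iu (fun x y => iff_refl _) (fun i => erefl).
have [Ev hEv] := fin_emb_self iv huv.2 tuv.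
have /choice[F HF] := fin_emb_exists.
have [E [e neE]] : exists E e, value (F (e |: E)) <> value (F E).
  apply: contrapT => no; apply: ne.
  rewrite (value_emb hEu (HF Eu)) (value_emb hEv (HF Ev)).
  apply: (finset_const (h := fun E => value (F E))) => A x.
  by apply: contrapT => h; apply: no; exists A, x.
have eE : e \notin E by apply/negP => eE; apply: neE; congr (value (F _));
  by apply/setUidPr; rewrite sub1set.
(* If [e] were not an admissible edge, [fin_thg] would ignore it and the value could not change. *)
have [s0 [is0 [Qs0 Ee]]] : exists s0 : 'I_n.+1 -> 'I_m, injective s0 /\
    Q (fun k => ttag G (u (s0 k))) /\ e = s0 @: setT.
  apply: contrapT => no; apply: neE; apply: value_emb (HF E).
  have [h1 [h2 [h3 h4]]] := HF (e |: E); split=> //; split=> //; split=> // s.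
  rewrite -h3 /=; split=> -[is_ [q h]]; split=> //; split=> //.
    by rewrite in_setU1 h orbT.
  move: h; rewrite in_setU1 => /orP[/eqP h|//].
  by case: no; exists s.
subst e; exists (fun x : V => [pick j | s0 (lift ord_max j) == (g x).1]).
have vE f : thg_emb (fin_thg E) G f -> value f = value (F E) by move=> h; exact: value_emb h (HF E).
have vE' f : thg_emb (fin_thg (s0 @: setT |: E)) G f -> value f = value (F (s0 @: setT |: E)).
  by move=> h; exact: value_emb h (HF _).
case: (ltgtP (value (F (s0 @: setT |: E))) (value (F E))) => [lt|lt|//].
  exact: (edge_flip_ip is0 eE (pos := true) lt vE' vE).
exact: (edge_flip_ip is0 eE (pos := false) lt vE vE').
Qed.

End Injective.

Theorem nonindiscernible_ip (m : nat) (u v : 'I_m -> I) : qf_eq_lt (tlt G) u v ->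
  (forall i, ttag G (u i) = ttag G (v i)) -> ~ same_type (seq_tuple a u) (seq_tuple a v) ->
  ~ n_dependent M n.
Proof.
move=> [q1 q2] ht nst nd; apply: nst => V g phi fphi; apply: contrapT => ne.
(* [c] removes the repetitions of [u]; equalities are part of the type, so [v] repeats in the same
   places. *)
have [m' [c [ic hc]]] := injective_enumeration [seq u i | i <- enum 'I_m].
have /choice[pi Hpi] : forall i, exists i', c i' = u i.
  by move=> i; apply/hc/In_codom; exists i.
have /choice[sg Hsg] : forall i', exists i, u i = c i'.
  by move=> i'; apply/In_codom/hc; exists i'.
have usp i : u (sg (pi i)) = u i by rewrite Hsg Hpi.
have vsp i : v (sg (pi i)) = v i by apply/q1.
apply: nd; exists V; have [|||||part IPp] := @injective_nonindiscernible_ip m'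
  (fun i => u (sg i)) (fun i => v (sg i)) _ _ _ _ V (fun x => (pi (g x).1, (g x).2)) phi fphi.
- by move=> i j; rewrite !Hsg => /ic.
- by move=> i j /q1; rewrite !Hsg => /ic.
- by split=> i j.
- by move=> i.
- rewrite /value /= => E; apply: ne; move: E.
  rewrite (_ : (fun w => a (u _) _) = (fun x => seq_tuple a u (g x))); last first.
    by apply/funext => x; rewrite usp.
  rewrite (_ : (fun w => a (v _) _) = (fun x => seq_tuple a v (g x))) //.
  by apply/funext => x; rewrite vsp.
by exists part, phi.
Qed.

End NonIndiscernible.

(** * Indiscernible sequences that separate edges from non-edges *)

Section NonDependent.
Variables (M : cstruct) (n t : nat) (Q : ('I_n.+1 -> 'I_t) -> Prop) (tau : 'I_n.+1 -> 'I_t).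
Hypothesis Qsym : forall tau (s : {perm 'I_n.+1}), Q tau -> Q (fun k => tau (s k)).
Hypothesis Qtau : forall s : 'I_n.+1 -> 'I_n.+1, injective s -> Q (fun k => tau (s k)).
Hypothesis tau_mono : forall i j, (tau i < tau j)%N -> (i < j)%N.
Hypothesis MM : monster M.

Definition gen_og : og_on n (gvert t) := OG (tlt (gen_thg Q)) (tR (gen_thg Q)).

Lemma gen_is_ohg : is_ohg gen_og.
Proof.
have [h1 [h2 [h3 _]]] := gen_is_thg Qsym.
by split=> //; split=> // a /h3[].
Qed.

Theorem ip_nonindiscernible : ~ n_dependent M n -> exists (V : finType) (a : gvert t -> V -> M),
  og_indiscernible gen_og a /\ exists u v : 'I_n.+1 -> gvert t,
  qf_eq_lt (glt gen_og) u v /\ (forall i, (u i).1 = (v i).1) /\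
  ~ same_type (seq_tuple a u) (seq_tuple a v).
Proof.
move=> /contrapT[V [part [f [ff [r [s [rs [a0 IP]]]]]]]].
have [a [inda ha]] := ip_indiscernible MM ff IP gen_is_ohg (gvert_countable t).
exists V, a; split=> //.
(* The complete and the edgeless structures on [n.+1] points share order and tags; [f] is at most
   [r] on a copy of the first and at least [s] on a copy of the second. *)
pose F (b : bool) : thg t n 'I_n.+1 := THG (fun x y : 'I_n.+1 => (x < y)%N)
  (fun s : 'I_n.+1 -> 'I_n.+1 => b /\ injective s) tau.
have HF b : is_thg Q (F b).
  split; [|split; [|split]] => //=.
  - split; [|split] => [x|x y z|x y]; rewrite ?ltnn //; first exact: ltn_trans.
    by case: (ltngtP x y) => [||/val_inj]; auto.
  - by move=> c p [hb inj]; split=> // i j /inj /perm_inj.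
  - by move=> c [_ inj]; split=> //; exact: Qtau.
have cI : countable_type 'I_n.+1 by exists val; exact: val_inj.
have EG := gen_ext_prop (Q := Q).
have [u [iu [u1 [u2 u3]]]] := ext_prop_embeds EG cI (HF true).
have [v [iv [v1 [v2 v3]]]] := ext_prop_embeds EG cI (HF false).
exists u, v; split.
  split=> i j; last exact: iff_trans (iff_sym (u1 i j)) (v1 i j).
  by split=> [/iu->|/iv->].
split; first by move=> i; rewrite -[LHS]u3 -[RHS]v3.
move=> st; have := st V (fun x => (slot (part x), x)) f ff.
have [h1 _] := ha u iu; have [_ h2] := ha v iv.
have le1 : f (combine part a u) <= r by apply: h1; apply/(u2 id); split.
have le2 : s <= f (combine part a v) by apply: h2; move/(v2 id) => [].
move=> E; have le3 : f (combine part a v) <= r by rewrite (_ : f (combine part a v) = f (combine part a u)).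
by have := le_trans le2 le3; rewrite leNgt rs.
Qed.

End NonDependent.

(** * Translation between tagged hypergraphs and the two kinds of structures in the statement *)

Section Transfer.
Variable n : nat.

Definition og_thg (I : Type) (G : og_on n I) : thg 1 n I := THG (glt G) (gR G) (fun=> ord0).
Definition no_cond (tau : 'I_n.+1 -> 'I_1) : Prop := True.

Lemma og_thg_is_thg (I : Type) (G : og_on n I) : is_ohg G -> is_thg no_cond (og_thg G).
Proof.
move=> [h1 [h2 h3]]; split=> //; split=> //; split=> [b /h3 inj|x y]; first by split.
by rewrite /= ltnn.
Qed.

Lemma is_G_thg (I : Type) (G : og_on n I) : is_G G ->
  is_thg no_cond (og_thg G) /\ ext_prop no_cond (og_thg G).
Proof.
move=> [h1 [h2 [h3 h4]]]; split; first exact: og_thg_is_thg.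
apply: univ_homog_ext_prop.
  move=> m F [f1 [f2 [f3 f4]]].
  have [|f [e1 [e2 e3]]] := h3 m (OG (tlt F) (tR F)).
    by split=> //; split=> // b /f3[].
  by exists f; split=> //; split=> //; split=> // x; rewrite [LHS]ord1.
move=> m u v iu iv hlt hR _; have [s [bs [[e1 [e2 e3]] hs]]] := h4 m u v iu iv hlt hR.
by exists s; split=> //; split.
Qed.

(** Provides the index structure to which condition (3) is applied in deducing (1). *)
Lemma gen_is_G : is_G (gen_og no_cond).
Proof.
have HG : is_thg no_cond (gen_thg no_cond) by apply: gen_is_thg.
have EG := gen_ext_prop (Q := no_cond).
split; first exact: gen_is_ohg.
split; first exact: gvert_countable.
split.
  move=> m F HF; have cm : countable_type 'I_m by exists val; exact: val_inj.
  have [f [e1 [e2 [e3 _]]]] := ext_prop_embeds EG cm (og_thg_is_thg HF).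
  by exists f.
move=> m u v iu iv hlt hR.
have [|s [bs [[e1 [e2 [e3 _]]] hs]]] := ext_prop_homog EG (gvert_countable 1) HG iu iv hlt hR.
  by move=> i; rewrite [LHS]ord1 [RHS]ord1.
by exists s.
Qed.

Definition inj_cond (tau : 'I_n.+1 -> 'I_n.+1) : Prop := injective tau.

Lemma inj_cond_sym (tau : 'I_n.+1 -> 'I_n.+1) (s : {perm 'I_n.+1}) :
  inj_cond tau -> inj_cond (fun k => tau (s k)).
Proof. by move=> h i j /h /perm_inj. Qed.

Lemma ophg_tag (I : Type) (G : opg_on n I) : is_ophg G -> exists tag : I -> 'I_n.+1,
  (forall i x, oP G i x <-> tag x = i) /\ is_thg inj_cond (THG (olt G) (oR G) tag).
Proof.
move=> [h1 [h2 [h3 [h4 h5]]]].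
have /choice[tag Htag] : forall x, exists i, oP G i x /\ forall j, oP G j x -> i = j.
  by move=> x; have [i [? ?]] := h2 x; exists i.
have tagP i x : oP G i x <-> tag x = i.
  by split=> [|<-]; [exact: (Htag x).2 | exact: (Htag x).1].
exists tag; split=> //; split; [|split; [|split]] => //=.
  move=> b Rb.
  (* An edge meets each of the [n.+1] parts, so its tag map has a right inverse and is a
     bijection. *)
  have /choice[sg Hsg] : forall i, exists k, tag (b k) = i.
    by move=> i; have [x [/tagP Px [[k Ek] _]]] := h5 _ Rb i; exists k; rewrite Ek.
  have isg : injective sg by move=> i j E; rewrite -(Hsg i) -(Hsg j) E.
  have inj : injective (fun k => tag (b k)).
    move=> k k'; have [sg' c1 c2] := injF_bij isg.
    by rewrite -(c2 k) -(c2 k') !Hsg => ->.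
  by split=> // i j E; apply: inj; rewrite E.
by move=> x y lt; apply: (h3 _ _ x y lt); apply/tagP.
Qed.

Lemma thg_ophg (I : Type) (T : thg n.+1 n I) : is_thg inj_cond T ->
  is_ophg (OPG (tlt T) (tR T) (fun i x => ttag T x = i)).
Proof.
move=> [h1 [h2 [h3 h4]]]; split=> //=; split; first by move=> x; exists (ttag T x).
split; first by move=> i j x y lt Ei Ej; apply: h4; rewrite Ei Ej.
split=> // b /h3[ib iq] i.
have [sg c1 c2] := injF_bij iq.
exists (b (sg i)); split; first exact: c2.
by split; [exists (sg i) | move=> k E; congr b; apply: iq; rewrite c2].
Qed.

Lemma is_Gp_thg (I : Type) (G : opg_on n I) : is_Gp G -> exists tag : I -> 'I_n.+1,
  (forall i x, oP G i x <-> tag x = i) /\ is_thg inj_cond (THG (olt G) (oR G) tag) /\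
  ext_prop inj_cond (THG (olt G) (oR G) tag).
Proof.
move=> [h1 [h2 [h3 h4]]]; have [tag [tagP HT]] := ophg_tag h1.
exists tag; split=> //; split=> //; apply: univ_homog_ext_prop.
  move=> m F HF; have [f [e1 [e2 [e3 e4]]]] := h3 m _ (thg_ophg HF).
  by exists f; split=> //; split=> //; split=> // x; apply: esym; apply: (tagP _ _).1; exact: (e4 _ _).1.
move=> m u v iu iv hlt hR htag; have [|s [bs [[e1 [e2 [e3 e4]]] hs]]] := h4 m u v iu iv hlt hR.
  by move=> k i; rewrite !tagP; move: (htag i) => /= ->.
exists s; split=> //; split=> //; split=> //; split=> //; split=> // x.
by apply: esym; apply: (tagP _ _).1; apply: (e4 _ _).1; apply: (tagP _ _).2.
Qed.

Definition gen_opg : opg_on n (gvert n.+1) :=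
  OPG (tlt (gen_thg inj_cond)) (tR (gen_thg inj_cond)) (fun i x => x.1 = i).

Lemma gen_is_Gp : is_Gp gen_opg.
Proof.
have HG := gen_is_thg inj_cond_sym.
have EG := gen_ext_prop (Q := inj_cond).
split; first exact: (thg_ophg HG).
split; first exact: gvert_countable.
split.
  move=> m F /ophg_tag[tag [tagP HF]].
  have cm : countable_type 'I_m by exists val; exact: val_inj.
  have [f [e1 [e2 [e3 e4]]]] := ext_prop_embeds EG cm HF.
  by exists f; split=> //; split=> //; split=> // i x; rewrite tagP (e4 x : tag x = (f x).1).
move=> m u v iu iv hlt hR hP.
have [|s [bs [[e1 [e2 [e3 e4]]] hs]]] := ext_prop_homog EG (gvert_countable n.+1) HG iu iv hlt hR.
  by move=> i; apply/esym; apply/(hP _ i).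
exists s; split=> //; split=> //; split=> //; split=> //; split=> // i x.
by rewrite /= (e4 x : x.1 = (s x).1).
Qed.

End Transfer.

Theorem theorem4p13 (M : cstruct) (n : nat) :
  monster M -> (0 < n)%N ->
  (n_dependent M n <->
   (forall (I : Type) (G : opg_on n I), is_Gp G ->
      forall (K : Type) (a : I -> K -> M), opg_indiscernible G a -> op_indiscernible G a))
  /\
  ((forall (I : Type) (G : opg_on n I), is_Gp G ->
      forall (K : Type) (a : I -> K -> M), opg_indiscernible G a -> op_indiscernible G a)
   <->
   (forall (I : Type) (G : og_on n I), is_G G ->
      forall (K : Type) (a : I -> K -> M), og_indiscernible G a -> order_indiscernible (glt G) a)).
Proof.
move=> MM _.
set S2 := forall I (G : opg_on n I), _; set S3 := forall I (G : og_on n I), _.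
have H12 : n_dependent M n -> S2.
  move=> nd I G /is_Gp_thg[tag [tagP [HG EG]]] K a ind m u v hlt hP.
  apply: contrapT => nst.
  apply: (nonindiscernible_ip (@inj_cond_sym n) HG EG _ hlt _ nst nd).
    move=> m' u' v' hlt' hR' htag'; apply: ind => // k i.
    by rewrite !tagP; move: (htag' i) => /= ->.
  by move=> i; apply/esym/tagP/hP/tagP.
have H13 : n_dependent M n -> S3.
  move=> nd I G /is_G_thg[HG EG] K a ind m u v hlt.
  apply: contrapT => nst.
  by apply: (nonindiscernible_ip _ HG EG _ hlt _ nst nd) => // m' u' v' hlt' hR' _; apply: ind.
have H21 : S2 -> n_dependent M n.
  move=> h2; apply: contrapT => nd.
  have [|V [a [ind [u [v [hlt [htag nst]]]]]]] :=
    @ip_nonindiscernible M n n.+1 (@inj_cond n) id (@inj_cond_sym n) (fun s h => h) _ MM nd.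
    by [].
  apply: nst; apply: (h2 _ _ (gen_is_Gp n)) => //.
    (* The sequence is indiscernible already for the order and [R], without the parts. *)
    by move=> m u' v' hlt' hR' _; apply: ind.
  by move=> k i; rewrite /= htag.
have H31 : S3 -> n_dependent M n.
  move=> h3; apply: contrapT => nd.
  have [|||V [a [ind [u [v [hlt [htag nst]]]]]]] :=
    @ip_nonindiscernible M n 1 (@no_cond n) (fun=> ord0) _ _ _ MM nd => //.
  by apply: nst; apply: (h3 _ _ (gen_is_G n)).
split; split; [exact: H12 | exact: H21 | by move/H21/H13 | by move/H31/H12].
Qed.
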